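(* Let $n\ge4$ and $\frac{\sqrt{n-1}}2<t\le\frac{\sqrt n}2$, and $a^{[n]}=\frac1{\sqrt n}(1,\dots,1)$. Then for all $a\in S^{n-1}$, $$P(a,t)\le P(a^{[n]},t)=\frac{\sqrt{n-1}}{(n-2)!}\,n^{n/2}\Big(\frac12\sqrt n-t\Big)^{n-2}.$$ For $n=3$ the same holds if $0.725<t\le\frac{\sqrt3}2$.
   Context: $Q^n=[-\frac12,\frac12]^n\subset\mathbb{R}^n$ is the unit-volume cube with boundary $\partial Q^n$. For $a\in S^{n-1}$, $t\in\mathbb{R}$, $H_t(a)=\{x\in\mathbb{R}^n:\langle a,x\rangle=t\}$ and the perimeter function is $P(a,t)=\mathrm{vol}_{n-2}(H_t(a)\cap\partial Q^n)$. *)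

(* Defs.v *)
From mathcomp Require Import all_boot all_order all_algebra.
From mathcomp Require Import all_classical all_reals all_analysis.
Set Implicit Arguments. Unset Strict Implicit. Unset Printing Implicit Defensive.
Import Order.TTheory GRing.Theory Num.Theory.
Import numFieldNormedType.Exports.
Local Open Scope classical_set_scope.
Local Open Scope ring_scope.

Section Defs.
Variable R : realType.

Definition edist (n : nat) (x y : 'rV[R]_n) : R :=
  Num.sqrt (\sum_(i < n) (x ord0 i - y ord0 i) ^+ 2).

(* Euclidean diameter, with the convention diam(empty set) = 0. *)
Definition ediam (n : nat) (A : set 'rV[R]_n) : \bar R :=
  ereal_sup ([set 0%E] `|`
             [set d | exists x y, A x /\ A y /\ d = (edist x y)%:E]).

Fixpoint ball_vol (m : nat) : R :=
  match m with
  | 0 => 1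
  | 1 => 2
  | (k.+2) as m' => 2 * pi / m'%:R * ball_vol k
  end.

(* delta-approximation of the m-dimensional Hausdorff measure in R^n,
   normalised so that it agrees with Lebesgue measure on m-flats. *)
Definition hausdorff_delta (n m : nat) (delta : R) (A : set 'rV[R]_n) : \bar R :=
  ereal_inf [set s | exists E : nat -> set 'rV[R]_n,
     (forall k, (ediam (E k) <= delta%:E)%E) /\
     A `<=` \bigcup_k E k /\
     s = (\sum_(0 <= k <oo)
            ((ball_vol m / 2 ^+ m * (fine (ediam (E k))) ^+ m)%:E))%E].

Definition hausdorff (n m : nat) (A : set 'rV[R]_n) : \bar R :=
  ereal_sup [set hausdorff_delta m delta A | delta in [set d : R | 0 < d]].

Definition cube (n : nat) : set 'rV[R]_n :=
  [set x | forall i : 'I_n, - (1 / 2) <= x ord0 i <= 1 / 2].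

Definition cube_boundary (n : nat) : set 'rV[R]_n :=
  closure (@cube n) `\` interior (@cube n).

Definition sphere (n : nat) : set 'rV[R]_n :=
  [set a | \sum_(i < n) (a ord0 i) ^+ 2 = 1].

Definition hyperplane (n : nat) (a : 'rV[R]_n) (t : R) : set 'rV[R]_n :=
  [set x | \sum_(i < n) a ord0 i * x ord0 i = t].

Definition perimeter (n : nat) (a : 'rV[R]_n) (t : R) : \bar R :=
  @hausdorff n n.-2 (hyperplane a t `&` @cube_boundary n).

Definition diag_dir (n : nat) : 'rV[R]_n := \row_(i < n) (Num.sqrt n%:R)^-1.

End Defs.

Arguments cube {R} n.
Arguments cube_boundary {R} n.
Arguments diag_dir {R} n.
Arguments hausdorff {R n} m A.

(* Main.v *)
From HB Require Import structures.
From mathcomp Require Import all_boot all_order all_algebra.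
From mathcomp Require Import all_classical all_reals all_analysis.
From mathcomp Require Import measurable_realfun ring lra.
Require Import Defs.
Import Order.TTheory GRing.Theory Num.Theory.
Import numFieldNormedType.Exports.
Local Open Scope classical_set_scope.
Local Open Scope ring_scope.
Set Implicit Arguments. Unset Strict Implicit. Unset Printing Implicit Defensive.

(**
When [t > sqrt (n - 1) / 2] the hyperplane cuts off only one vertex of the cube, so the section is a simplex with vertices at distances [s / |a_i|] from that vertex along the edges, with [s = sum |a_i| / 2 - t] (it is empty if [s < 0], in particular if some [a_i] vanishes). Its boundary consists of [n] simplices of dimension [m = n - 2], and the perimeter is [s^m / (m! prod |a_i|) * sum |a_i| sqrt (1 - a_i^2)]. By AM-GM the sum is at most [sqrt (n - 1)], and [s^m <= prod (sqrt n |a_i|) (sqrt n / 2 - t)^m] reduces, with [b_i = sqrt n |a_i|] and [r] the ratio of [s] to its maximal value, to [r^2 <= prod b_i] if [n >= 4], which follows from [b >= exp (- (1 - b) - 4/3 (1 - b)^2)] for [b >= 1/4], at most one [b_i] being smaller; for [n = 3] it is a polynomial inequality in the smallest [b_i].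

A facet is the isometric image of a simplex of [R^m] with the norm [sqrt (|v|^2 + <c, v>^2)] obtained by eliminating a coordinate, so that its Hausdorff measure has to be compared with Lebesgue measure in that norm. The lower bound is the isodiametric inequality, which follows from Brunn-Minkowski applied to [A - A]. For the upper bound let [h] be the infimum of the costs of the finite covers of a cube: covering an inscribed ball by itself, and the cells of a fine grid not inside the ball by scaled copies of a cover of the cube, gives [h <= |B| + (1 - |B|) h] up to an arbitrarily small error, for the cube of volume 1, hence [h <= 1]. The volume of the unit ball of the norm is found by integrating [exp (- |v|^2 - <c, v>^2)] in two ways.
*)

(** * Lebesgue measure on finite powers of the line *)

(** The hypothesis [t > sqrt (n - 1) / 2] acts through Cauchy-Schwarz on n - 1 coordinates: a
    nonempty section has no vanishing a_i and avoids the facets opposite to the vertex that is cut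
    off, and T = 2 t sqrt n lies within 6/11 of n when n >= 4. Since sum b_i^2 = n, the two sums sum
    (1 - b_i) = n - sum b_i and sum (1 - b_i)^2 = 2 (n - sum b_i) are governed by a single deficit.
    The bound with the coefficient 4/3 therefore has exponent (1 + 8/3) (n - sum b_i), where n - sum
    b_i = (n - T) (1 - r), and 11/3 * 6/11 = 2 is just what r^2 <= exp (- 2 (1 - r)) asks for. For n
    = 3 the power to be bounded is r itself. Near b = (1, 1, 1) the inequality r <= prod b_i forces
    3 - T <= 1/2, that is t >= 5 / (4 sqrt 3) = 0.7217..., which exceeds sqrt 2 / 2; the value 0.725
    leaves a little room for a proof with rational constants. *)

Section Space.
Variable R : realType.
Local Notation mu := (@lebesgue_measure R).

Section Product.
Variables (d1 d2 : measure_display) (T1 : measurableType d1)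
  (T2 : measurableType d2).
Variables (m1 : {sigma_finite_measure set T1 -> \bar R})
  (m2 : {sigma_finite_measure set T2 -> \bar R}).

(** The product is bundled again with its sigma-finiteness so that it can serve as a factor of the
    next product in [vol]. *)
Definition sfprod : set (T1 * T2) -> \bar R := (m1 \x m2)%E.

HB.instance Definition _ := Measure.on sfprod.

Let sfprod_sigma_finite : sigma_finite setT sfprod.
Proof.
have /sigma_finiteP[F [TF ndF Foo]] := sigma_finiteT m1.
have /sigma_finiteP[G [TG ndG Goo]] := sigma_finiteT m2.
exists (fun n => F n `*` G n).
  rewrite -setXTT TF TG predeqE => -[x y]; split.
    move=> [/= [n _ Fnx] [k _ Gky]]; exists (maxn n k) => //; split.
    - by move: x Fnx; exact/subsetPset/ndF/leq_maxl.
    - by move: y Gky; exact/subsetPset/ndG/leq_maxr.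
  by move=> [n _ []/= ? ?]; split; exists n.
move=> k; have [? ?] := Foo k; have [? ?] := Goo k.
split; first exact: measurableX.
by rewrite /sfprod product_measure1E// lte_mul_pinfty// ge0_fin_numE.
Qed.

HB.instance Definition _ :=
  Measure_isSigmaFinite.Build _ _ _ sfprod sfprod_sigma_finite.

End Product.

(** The display of a product depends on those of its factors, so the recursion has to return the
    display together with the type. Iterated products make Tonelli available one coordinate at a
    time. *)
Fixpoint Rpow_pack (m : nat) : {d : measure_display & measurableType d} :=
  match m with
  | 0 => existT (fun d => measurableType d) _ unit
  | k.+1 => existT (fun d => measurableType d) _
              (measurableTypeR R * projT2 (Rpow_pack k))%type
  end.
Definition Rpow m := projT2 (Rpow_pack m).

Fixpoint vol (m : nat) : {sigma_finite_measure set (Rpow m) -> \bar R} :=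
  match m return {sigma_finite_measure set (Rpow m) -> \bar R} with
  | 0 => (dirac tt : {sigma_finite_measure set unit -> \bar R})
  | k.+1 => sfprod mu (vol k)
  end.

(* Points of [Rpow m] are handled through their coordinates, as functions on [nat]
   of which only the values at [i < m] matter. *)
Fixpoint coords (m : nat) : Rpow m -> nat -> R :=
  match m return Rpow m -> nat -> R with
  | 0 => fun _ _ => 0
  | k.+1 => fun u i => match i with 0 => u.1 | j.+1 => coords u.2 j end
  end.

Fixpoint of_coords (m : nat) (f : nat -> R) : Rpow m :=
  match m return Rpow m with
  | 0 => tt
  | k.+1 => (f 0%N, of_coords k (fun i => f i.+1))
  end.

Lemma coords_of_coords m f i : (i < m)%N -> coords (of_coords m f) i = f i.
Proof. by elim: m f i => [//|m IH] f [//|i] /=; rewrite ltnS => /IH ->. Qed.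

Lemma volS m (A : set (Rpow m.+1)) : vol m.+1 A = (\int[mu]_x vol m (xsection A x))%E.
Proof. by []. Qed.

Lemma measurable_coords m i : measurable_fun setT (fun u : Rpow m => coords u i : measurableTypeR R).
Proof.
elim: m i => [|m IH] [|i] /=; [exact: measurable_cst|exact: measurable_cst| | ].
  exact: measurable_fst.
apply: (measurableT_comp (IH i)); exact: measurable_snd.
Qed.

Lemma measurable_lt_set d (X : measurableType d) (f g : X -> R) :
  measurable_fun setT f -> measurable_fun setT g ->
  measurable [set x | f x < g x].
Proof.
move=> mf mg; rewrite -[X in measurable X]setTI.
exact: (measurable_fun_ltr mf mg measurableT (Y := [set true])).
Qed.

Lemma measurable_le_set d (X : measurableType d) (f g : X -> R) :
  measurable_fun setT f -> measurable_fun setT g ->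
  measurable [set x | f x <= g x].
Proof.
move=> mf mg; rewrite -[X in measurable X]setTI.
exact: (measurable_fun_ler mf mg measurableT (Y := [set true])).
Qed.

Lemma measurable_affine (l b : R) :
  measurable_fun [set: measurableTypeR R]
    (fun x : measurableTypeR R => l * x + b : measurableTypeR R).
Proof.
apply: measurable_funD; last exact: measurable_cst.
exact: measurable_funM.
Qed.

Lemma lebesgue_measure_pos_affine (l b : R) (A : set (measurableTypeR R)) :
  0 < l -> measurable A ->
  mu ((fun x => l * x + b) @^-1` A) = (l^-1%:E * mu A)%E.
Proof.
move=> l0 mA.
have l1 : 0 <= l by exact: ltW.
pose f : measurableTypeR R -> measurableTypeR R := fun x => l * x + b.
have mf : measurable_fun setT f := measurable_affine l b.
(* The pushforward scaled by [l] gives every half-open interval its length, so it is Lebesgue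
   measure by uniqueness. *)
pose m' : {measure set (measurableTypeR R) -> \bar R} := mscale (NngNum l1)
  (measure_function_pushforward__canonical__measure_function_Measure mu mf).
have m'E : forall X, measurable X -> mu X = m' X.
  apply: (@lebesgue_measure_unique R m') => //= _ [[a c]] _ <-.
  rewrite /mscale/= /pushforward /=.
  have -> : f @^-1` `]a, c] = `](a - b) / l, (c - b) / l]%classic.
    apply/seteqP; split => x /=; rewrite !in_itv/= /f.
      by rewrite ltr_pdivrMr// ler_pdivlMr// mulrC ltrBlDr lerBrDr.
    by rewrite ltr_pdivrMr// ler_pdivlMr// mulrC ltrBlDr lerBrDr.
  rewrite !lebesgue_measure_itv/= !lte_fin.
  rewrite ltr_pM2r ?invr_gt0// ltrD2r.
  case: ifP => _; last by rewrite mule0.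
  rewrite -!EFinB -EFinM; congr (_%:E).
  by field; rewrite gt_eqF.
rewrite -/(pushforward mu f A) (m'E A mA) /m' /mscale /= muleA -EFinM.
by rewrite mulVf ?mul1e// gt_eqF.
Qed.

Lemma lebesgue_measure_affine (l b : R) (A : set (measurableTypeR R)) :
  l != 0 -> measurable A ->
  mu ((fun x => l * x + b) @^-1` A) = (`|l|^-1%:E * mu A)%E.
Proof.
move=> l0 mA; have [lp|ln|l00] := ltgtP 0 l.
- by rewrite gtr0_norm//; exact: lebesgue_measure_pos_affine.
- rewrite ltr0_norm//.
  have mB : measurable ((fun x : measurableTypeR R => - l * x + b) @^-1` A).
    by rewrite -[X in measurable X]setTI; apply: measurable_affine.
  rewrite -(lebesgue_measure_pos_affine b) ?oppr_gt0// -(lebesgue_measureN mB).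
  congr mu; apply/seteqP; split => x /=; rewrite /= mulrNN//.
- by rewrite -l00 eqxx in l0.
Qed.

Definition box m (lo hi : nat -> R) : set (Rpow m) :=
  [set u | forall i, (i < m)%N -> lo i <= coords u i < hi i].

Arguments box m lo hi : clear implicits.

Lemma boxS m lo hi : box m.+1 lo hi =
  (`[lo 0%N, hi 0%N[%classic : set (measurableTypeR R)) `*`
  box m (fun i => lo i.+1) (fun i => hi i.+1).
Proof.
apply/seteqP; split => [[x u] h|[x u] [/= h0 h] [_|i im]].
- split; first by have := h 0%N isT; rewrite /= in_itv.
  by move=> i im; exact: (h i.+1).
- by move: h0; rewrite in_itv.
- exact: (h i).
Qed.

Lemma measurable_box m lo hi : measurable (box m lo hi).
Proof.
elim: m lo hi => [|m IH] lo hi.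
  rewrite (_ : box 0 _ _ = setT) //.
  by apply/seteqP; split.
rewrite boxS; apply: measurableX; [exact: measurable_itv|exact: IH].
Qed.

Lemma vol_box m lo hi : (forall i, (i < m)%N -> lo i <= hi i) ->
  vol m (box m lo hi) = (\prod_(i < m) (hi i - lo i))%:E.
Proof.
elim: m lo hi => [|m IH] lo hi lohi.
  rewrite big_ord0 (_ : box 0 _ _ = setT) /=; first by rewrite diracT.
  by apply/seteqP; split.
have mb := measurable_box m (fun i => lo i.+1) (fun i => hi i.+1).
rewrite boxS /vol/= /sfprod product_measure1E//.
rewrite -/(vol m) IH; last by move=> i im; exact: (lohi i.+1).
rewrite big_ord_recl EFinM; congr (_ * _)%E.
transitivity (lebesgue_measure (`[lo 0%N, hi 0%N[%classic : set R)) => //.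
rewrite lebesgue_measure_itv/= lte_fin.
by have := lohi 0%N isT; rewrite le_eqVlt => /predU1P[->|->]; rewrite ?ltxx ?subrr ?EFinB.
Qed.

(** The constant [K] is the same for all sets, so it bounds all sections of a bounded set at
    once. *)
Lemma vol_bounded m (M : R) : exists K : R, forall A : set (Rpow m), measurable A ->
  (forall u, A u -> forall i, (i < m)%N -> `|coords u i| <= M) ->
  (vol m A <= K%:E)%E.
Proof.
pose N : R := Num.max M 0 + 1.
exists (\prod_(i < m) (N - - N)) => A mA AM.
have h : A `<=` box m (fun=> - N) (fun=> N).
  move=> u /AM h i /h; rewrite ler_norml => /andP[h1 h2].
  have h3 : M <= Num.max M 0 by rewrite le_max lexx.
  by apply/andP; split; rewrite /N; lra.
have <- : vol m (box m (fun=> - N) (fun=> N)) = (\prod_(i < m) (N - - N))%:E.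
  rewrite vol_box// => i _; have h3 : 0 <= Num.max M 0 by rewrite le_max lexx orbT.
  rewrite /N; lra.
by apply: le_measure; rewrite ?inE//; exact: measurable_box.
Qed.

End Space.
Arguments vol {R} m.
Arguments box {R} m lo hi.
Arguments of_coords {R} m f.

(** * Brunn-Minkowski inequality *)

Section BM.
Variable R : realType.
Local Notation mu := (@lebesgue_measure R).

(** With [a] near [sup A] and [b] near [sup B], the set A - b lies below [sup A - b] and a - B lies
    above [a - sup B]. Both are contained in [C], and they overlap in an interval of length at most
    [e], so their measures almost add up. *)
Lemma brunn_minkowski1 (M : R) (A B C : set (measurableTypeR R)) :
  measurable A -> measurable B -> measurable C ->
  A !=set0 -> B !=set0 ->
  (forall x, A x -> `|x| <= M) -> (forall x, B x -> `|x| <= M) ->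
  (forall x y, A x -> B y -> C (x - y)) ->
  (mu A + mu B <= mu C)%E.
Proof.
move=> mA mB mC A0 B0 AM BM ABC.
have sA : has_sup A.
  by split=> //; exists M => x /AM; rewrite ler_norml => /andP[].
have sB : has_sup B.
  by split=> //; exists M => x /BM; rewrite ler_norml => /andP[].
apply/lee_addgt0Pr => e e0.
have e2 : 0 < e / 2 by rewrite divr_gt0.
have [a Aa aS] := sup_adherent e2 sA.
have [b Bb bS] := sup_adherent e2 sB.
pose U : set (measurableTypeR R) := (fun x => 1 * x + b) @^-1` A.
pose V : set (measurableTypeR R) := (fun x => -1 * x + a) @^-1` B.
have mU : measurable U by rewrite -[X in measurable X]setTI; apply: measurable_affine.
have mV : measurable V by rewrite -[X in measurable X]setTI; apply: measurable_affine.
have UE : mu U = mu A.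
  by rewrite lebesgue_measure_affine ?oner_eq0// normr1 invr1 mul1e.
have VE : mu V = mu B.
  by rewrite lebesgue_measure_affine ?oppr_eq0 ?oner_eq0// normrN1 invr1 mul1e.
have UC : U `<=` C by move=> x Ux; have := ABC _ _ Ux Bb; rewrite mul1r addrK.
have VC : V `<=` C.
  by move=> x Vx; have := ABC _ _ Aa Vx; rewrite mulN1r opprD opprK addrC addrNK.
pose J := `[a - sup B, sup A - b]%classic : set (measurableTypeR R).
have mJ : measurable J by exact: measurable_itv.
have JE : (mu J <= e%:E)%E.
  rewrite /J lebesgue_measure_itv/= lte_fin; case: ifP => // _.
    by rewrite -EFinB lee_fin; lra.
  by rewrite lee_fin ltW.
have VJ : V `<=` (V `\` U) `|` J.
  move=> x Vx; have [Ux|nUx] := pselect (U x); last by left.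
  right; rewrite /J/= in_itv/=.
  have h1 := sup_upper_bound sA Ux; have h2 := sup_upper_bound sB Vx.
  by apply/andP; split; lra.
have mVU : measurable (V `\` U) by exact: measurableD.
have -> : mu A = mu U by [].
have h : (mu B <= mu (V `\` U) + mu J)%E.
  rewrite -VE; apply: (le_trans (le_measure _ _ _ VJ)); rewrite ?inE//.
    exact: measurableU.
  exact: measureU2.
apply: (@le_trans _ _ (mu U + (mu (V `\` U) + mu J))%E); first exact: leeD2l.
rewrite addeA; apply: leeD => //.
rewrite -measureU//; last by rewrite setDE setICA setICr setI0.
apply: le_measure; rewrite ?inE//; first exact: measurableU.
by move=> x [/UC//|[/VC]].
Qed.

Section layer.
Variables (d : measure_display) (X : measurableType d).
Variable m : {sigma_finite_measure set X -> \bar R}.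

(** Tonelli for the indicator of the region under the graph. *)
Lemma layer_cake (f : X -> R) : measurable_fun setT f -> (forall x, 0 <= f x) ->
  (\int[m]_x (f x)%:E = \int[mu]_(s in `]0%R, +oo[) m [set x | (s < f x)%R])%E.
Proof.
move=> mf f0.
pose P := [set z : X * measurableTypeR R | 0 < z.2 < f z.1].
have mP : measurable P.
  rewrite (_ : P = [set z : X * measurableTypeR R | (0 < z.2)] `&`
     [set z : X * measurableTypeR R | z.2 < f z.1]); last first.
    by apply/seteqP; split => z /=; [move=> /andP[]|move=> [? ?]; apply/andP].
  have ms : measurable_fun setT (fun z : X * measurableTypeR R => z.2 : R) by exact: measurable_snd.
  apply: measurableI; apply: measurable_lt_set => //.
  by apply: measurableT_comp => //; exact: measurable_fst.
have mI : measurable_fun setT (fun z : X * measurableTypeR R => (\1_P z : R)%:E).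
  exact/measurable_EFinP/measurable_indic.
have := @fubini_tonelli _ _ _ _ R m mu (fun z => (\1_P z)%:E) mI
   (fun z => ltac:(by rewrite lee_fin)).
have -> : (\int[m]_x \int[mu]_y (\1_P (x, y))%:E = \int[m]_x (f x)%:E)%E.
  apply: eq_integral => x _.
  rewrite (_ : (fun y => _) = (fun y : measurableTypeR R => (\1_(`]0%R, f x[%classic : set (measurableTypeR R)) y)%:E)); last first.
    apply/funext => y; rewrite !indicE; congr ((nat_of_bool _)%:R%:E).
  rewrite integral_indic//= setIT lebesgue_measure_itv/= lte_fin.
  by have := f0 x; rewrite le_eqVlt => /predU1P[<-|->]; rewrite ?ltxx ?oppr0 ?adde0.
move=> ->.
rewrite [RHS]integral_mkcond; apply: eq_integral => s _.
rewrite patchE; case: ifPn => [|sn].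
  rewrite inE/= in_itv/= andbT => s0.
  rewrite (_ : (fun x => _) = (fun x : X => (\1_[set x | s < f x] x)%:E)); last first.
    apply/funext => y; rewrite !indicE; congr ((nat_of_bool _)%:R%:E).
    by apply/idP/idP; rewrite !inE/= /P/= s0.
  rewrite integral_indic//= ?setIT//.
  exact: measurable_lt_set.
apply: integral0_eq => x _; rewrite indicE memNset// /P/=.
move: sn; rewrite notin_setE/= in_itv/= andbT => sn /andP[s0 _]; exact: sn.
Qed.

Lemma measurable_layer (f : X -> R) : measurable_fun setT f ->
  measurable_fun setT (fun s : measurableTypeR R => m [set x | (s : R) < f x]).
Proof.
move=> mf.
pose P := [set z : X * measurableTypeR R | (z.2 : R) < f z.1].
have mP : measurable P.
  have ms : measurable_fun setT (fun z : X * measurableTypeR R => z.2 : R) by exact: measurable_snd.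
  apply: measurable_lt_set => //.
  by apply: measurableT_comp => //; exact: measurable_fst.
have := measurable_fun_ysection m mP.
apply: eq_measurable_fun => s _ /=; congr (m _).
by apply/seteqP; split => x; rewrite /ysection/= inE.
Qed.

End layer.

(** Both suprema being 1, the level sets of [F] and [G] above any s < 1 are nonempty, and their
    differences lie in the level set of [H] above s. The one-dimensional Brunn-Minkowski inequality
    is integrated over the levels. *)
Lemma prekopa_leindler1_unit (M : R) (F G H : measurableTypeR R -> R) :
  measurable_fun setT F -> measurable_fun setT G -> measurable_fun setT H ->
  (forall x, 0 <= F x <= 1) -> (forall x, 0 <= G x <= 1) -> (forall x, 0 <= H x) ->
  (forall s, s < 1 -> exists x, s < F x) -> (forall s, s < 1 -> exists x, s < G x) ->
  (forall x, 0 < F x -> `|x : R| <= M) -> (forall x, 0 < G x -> `|x : R| <= M) ->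
  (forall x y, F x * G y <= H (x - y : R) ^+ 2) ->
  (\int[mu]_x (F x)%:E + \int[mu]_x (G x)%:E <= \int[mu]_x (H x)%:E)%E.
Proof.
move=> mF mG mH F01 G01 H0 Fs Gs FM GM FGH.
have F0 x : 0 <= F x by case/andP: (F01 x).
have G0 x : 0 <= G x by case/andP: (G01 x).
rewrite !layer_cake// -ge0_integralD//; last 2 first.
  by apply: measurable_funTS; exact: measurable_layer.
  by apply: measurable_funTS; exact: measurable_layer.
apply: ge0_le_integral => //=.
- by move=> s _; rewrite adde_ge0.
- apply: measurable_funTS; apply: emeasurable_funD; exact: measurable_layer.
- by apply: measurable_funTS; exact: measurable_layer.
move=> s; rewrite in_itv/= andbT => s0.
have [s1|s1] := ltP s 1; last first.
  rewrite (_ : [set x | s < F x] = set0); last first.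
    apply/seteqP; split => x //= h; have /andP[_ h'] := F01 x.
    by have := lt_le_trans h (le_trans h' s1); rewrite ltxx.
  rewrite (_ : [set x | s < G x] = set0); last first.
    apply/seteqP; split => x //= h; have /andP[_ h'] := G01 x.
    by have := lt_le_trans h (le_trans h' s1); rewrite ltxx.
  by rewrite measure0 adde0 measure_ge0.
apply: (@brunn_minkowski1 M) => //; try exact: measurable_lt_set.
- by have [x ?] := Fs _ s1; exists x.
- by have [x ?] := Gs _ s1; exists x.
- by move=> x /= h; apply: FM; exact: lt_trans h.
- by move=> x /= h; apply: GM; exact: lt_trans h.
move=> x y /= sF sG; rewrite -(@ltr_pXn2r _ 2)// ?nnegrE ?H0 ?ltW//.
by apply: lt_le_trans (FGH x y); rewrite expr2 ltr_pM// ltW.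
Qed.

(** Dividing [F] and [G] by their suprema reduces to the additive inequality for suprema 1; it
    becomes multiplicative through 4 x y <= (x + y)^2. *)
Lemma prekopa_leindler1 (M K : R) (F G H : measurableTypeR R -> R) :
  measurable_fun setT F -> measurable_fun setT G -> measurable_fun setT H ->
  (forall x, 0 <= F x <= K) -> (forall x, 0 <= G x <= K) -> (forall x, 0 <= H x) ->
  (forall x, 0 < F x -> `|x : R| <= M) -> (forall x, 0 < G x -> `|x : R| <= M) ->
  (forall x y, F x * G y <= H (x - y : R) ^+ 2) ->
  (4%:E * (\int[mu]_x (F x)%:E * \int[mu]_x (G x)%:E) <=
   \int[mu]_x (H x)%:E * \int[mu]_x (H x)%:E)%E.
Proof.
move=> mF mG mH FK GK H0 FM GM FGH.
have F0 x : 0 <= F x by case/andP: (FK x).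
have G0 x : 0 <= G x by case/andP: (GK x).
have IH0 : (0 <= \int[mu]_x (H x)%:E)%E by apply: integral_ge0 => x _; rewrite lee_fin.
have [[x0 Fx0]|nF] := pselect (exists x, 0 < F x); last first.
  have -> : (\int[mu]_x (F x)%:E = 0)%E; last by rewrite mul0e mule0 mule_ge0.
  apply: integral0_eq => x _ /=; congr (_%:E); apply/eqP; rewrite eq_le F0 andbT leNgt.
  by apply/negP => h; apply: nF; exists x.
have [[y0 Gy0]|nG] := pselect (exists x, 0 < G x); last first.
  have -> : (\int[mu]_x (G x)%:E = 0)%E; last by rewrite !mule0 mule_ge0.
  apply: integral0_eq => x _ /=; congr (_%:E); apply/eqP; rewrite eq_le G0 andbT leNgt.
  by apply/negP => h; apply: nG; exists x.
have sF : has_sup (range F).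
  by split; [exists (F x0); exists x0|exists K => _ [x _ <-]; case/andP: (FK x)].
have sG : has_sup (range G).
  by split; [exists (G y0); exists y0|exists K => _ [x _ <-]; case/andP: (GK x)].
pose a := sup (range F); pose b := sup (range G).
have Fa x : F x <= a by apply: (sup_upper_bound sF); exists x.
have Gb x : G x <= b by apply: (sup_upper_bound sG); exists x.
have a0 : 0 < a by exact: lt_le_trans (Fa x0).
have b0 : 0 < b by exact: lt_le_trans (Gb y0).
(* With this factor for [H] the hypothesis F x * G y <= H (x - y)^2 is preserved by the
   rescaling. *)
pose c := Num.sqrt (a * b).
have c0 : 0 < c by rewrite sqrtr_gt0 mulr_gt0.
have c2 : c ^+ 2 = a * b by rewrite sqr_sqrtr// mulr_ge0// ltW.
have scale (k : R) (f : measurableTypeR R -> R) : 0 < k -> measurable_fun setT f ->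
    (forall x, 0 <= f x) ->
    (\int[mu]_x (f x)%:E = k%:E * \int[mu]_x (f x / k)%:E)%E.
  move=> k0 mf f0; rewrite -ge0_integralZl_EFin//.
  - by apply: eq_integral => x _; rewrite -EFinM mulrCA divff ?mulr1// gt_eqF.
  - by move=> x _; rewrite lee_fin divr_ge0// ltW.
  - by apply/measurable_EFinP; apply: measurable_funM.
  - exact: ltW.
rewrite (scale a F)// (scale b G)// (scale c H)//.
have := @prekopa_leindler1_unit M (fun x => F x / a) (fun x => G x / b) (fun x => H x / c).
set IF := (\int[mu]_x (F x / a)%:E)%E; set IG := (\int[mu]_x (G x / b)%:E)%E.
set IH := (\int[mu]_x (H x / c)%:E)%E.
have IF0 : (0 <= IF)%E by apply: integral_ge0 => x _; rewrite lee_fin divr_ge0// ltW.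
have IG0 : (0 <= IG)%E by apply: integral_ge0 => x _; rewrite lee_fin divr_ge0// ltW.
have IHH0 : (0 <= IH)%E by apply: integral_ge0 => x _; rewrite lee_fin divr_ge0// ltW.
move=> h; have {h} : (IF + IG <= IH)%E.
  apply: h; try by apply: measurable_funM.
  - by move=> x; rewrite divr_ge0 ?(ltW a0)//= ler_pdivrMr// mul1r.
  - by move=> x; rewrite divr_ge0 ?(ltW b0)//= ler_pdivrMr// mul1r.
  - by move=> x; rewrite divr_ge0// ltW.
  - move=> s s1; have e0 : 0 < a - s * a by rewrite subr_gt0 gtr_pMl.
    have [_ [x _ <-] xs] := sup_adherent e0 sF; exists x.
    by rewrite ltr_pdivlMr//; move: xs; rewrite -/a; lra.
  - move=> s s1; have e0 : 0 < b - s * b by rewrite subr_gt0 gtr_pMl.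
    have [_ [x _ <-] xs] := sup_adherent e0 sG; exists x.
    by rewrite ltr_pdivlMr//; move: xs; rewrite -/b; lra.
  - by move=> x; rewrite pmulr_lgt0 ?invr_gt0//; exact: FM.
  - by move=> x; rewrite pmulr_lgt0 ?invr_gt0//; exact: GM.
  - move=> x y; rewrite expr_div_n c2 mulrACA -invfM ler_pM2r ?invr_gt0 ?mulr_gt0//.
case: IH IHH0 => [ih|_ _|//]; last first.
  by rewrite !gt0_muley ?lte_fin ?gt0_mulye ?leey.
case: IF IF0 => [iF|_|//]; last by case: IG IG0.
case: IG IG0 => [iG|_|//]; last by [].
rewrite -!EFinD !lee_fin => iG0 iF0 ih0 h.
have -> : c * ih * (c * ih) = (a * b) * ih ^+ 2 by rewrite -c2; ring.
have -> : 4 * (a * iF * (b * iG)) = (a * b) * (4 * (iF * iG)) by ring.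
rewrite ler_pM2l ?mulr_gt0//.
have : (iF + iG) ^+ 2 <= ih ^+ 2 by rewrite ler_pXn2r// nnegrE// addr_ge0.
by apply: le_trans; rewrite -subr_ge0 (_ : _ - _ = (iF - iG) ^+ 2) ?sqr_ge0//; ring.
Qed.

(** This multiplicative form passes to sections: the volumes of the sections of [A], [B] and [C] at
    x, y and x - y satisfy the hypothesis of [prekopa_leindler1], and each dimension contributes a
    factor 4. For A = B it says that A - A has at least 2^m times the volume of A. *)
Lemma brunn_minkowski m (M : R) (A B C : set (Rpow R m)) :
  measurable A -> measurable B -> measurable C ->
  (forall u, A u -> forall i, (i < m)%N -> `|coords u i| <= M) ->
  (forall u, B u -> forall i, (i < m)%N -> `|coords u i| <= M) ->
  (forall u, C u -> forall i, (i < m)%N -> `|coords u i| <= M) ->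
  (forall u v, A u -> B v -> C (of_coords m (fun i => coords u i - coords v i))) ->
  ((4 ^+ m)%:E * (vol m A * vol m B) <= vol m C * vol m C)%E.
Proof.
elim: m M A B C => [|m IH] M A B C mA mB mC AM BM CM ABC.
  rewrite expr0 mul1e /= !diracE -!EFinM lee_fin.
  have [/set_mem At|_] := boolP (tt \in A); last by rewrite mul0r mulr_ge0.
  have [/set_mem Bt|_] := boolP (tt \in B); last by rewrite mulr0 mulr_ge0.
  by rewrite mem_set//; exact: (ABC _ _ At Bt).
have [K KP] := vol_bounded m M.
have bnd (D : set (Rpow R m.+1)) x : measurable D ->
    (forall u, D u -> forall i, (i < m.+1)%N -> `|coords u i| <= M) ->
    (vol m (xsection D x) <= K%:E)%E.
  move=> mD DM; apply: KP; first exact: measurable_xsection.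
  by move=> u; rewrite /xsection/= inE => Du i im; exact: (DM _ Du i.+1).
have fin (D : set (Rpow R m.+1)) x : measurable D ->
    (forall u, D u -> forall i, (i < m.+1)%N -> `|coords u i| <= M) ->
    vol m (xsection D x) \is a fin_num.
  move=> mD DM; rewrite ge0_fin_numE//; exact: le_lt_trans (bnd D x mD DM) (ltry _).
pose sec (D : set (Rpow R m.+1)) (x : measurableTypeR R) := fine (vol m (xsection D x)).
have secE (D : set (Rpow R m.+1)) : measurable D ->
    (forall u, D u -> forall i, (i < m.+1)%N -> `|coords u i| <= M) ->
    vol m.+1 D = (\int[mu]_x (sec D x)%:E)%E.
  by move=> mD DM; rewrite volS; apply: eq_integral => x _; rewrite /sec fineK// fin.
have msec (D : set (Rpow R m.+1)) : measurable D -> measurable_fun setT (sec D).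
  move=> mD; apply: measurableT_comp => //.
  exact: (measurable_fun_xsection (vol m) mD).
have sec0 (D : set (Rpow R m.+1)) x : 0 <= sec D x by rewrite fine_ge0.
have secK (D : set (Rpow R m.+1)) x : measurable D ->
    (forall u, D u -> forall i, (i < m.+1)%N -> `|coords u i| <= M) ->
    sec D x <= K.
  by move=> mD DM; rewrite -lee_fin /sec fineK ?fin// bnd.
have secM (D : set (Rpow R m.+1)) x : measurable D ->
    (forall u, D u -> forall i, (i < m.+1)%N -> `|coords u i| <= M) ->
    0 < sec D x -> `|x : R| <= M.
  move=> mD DM h; suff [u Du] : xsection D x !=set0.
    by move: Du; rewrite /xsection/= inE => /DM /(_ 0%N isT).
  by apply/set0P; apply/eqP => E; move: h; rewrite /sec E measure0 ltxx.
have p4 : 0 < 4 ^+ m :> R by rewrite exprn_gt0.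
have m4 : measurable_fun setT (fun x => 4 ^+ m * sec A x).
  by apply: measurable_funM => //; exact: msec.
(* The factor [4 ^+ m] of the induction hypothesis is absorbed into the first function. *)
have := @prekopa_leindler1 M (Num.max (4 ^+ m * K) K)
  (fun x => 4 ^+ m * sec A x) (sec B) (sec C) m4 (msec B mB) (msec C mC).
have -> : (\int[mu]_x (4 ^+ m * sec A x)%:E = (4 ^+ m)%:E * \int[mu]_x (sec A x)%:E)%E.
  rewrite -ge0_integralZl_EFin//.
  - by move=> x _; rewrite lee_fin.
  - by apply/measurable_EFinP; exact: msec.
rewrite !secE// exprS EFinM -!muleA; apply.
- by move=> x; rewrite mulr_ge0 ?(ltW p4)//= le_max ler_pM2l// secK.
- by move=> x; rewrite sec0 le_max secK// orbT.
- by [].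
- by move=> x; rewrite pmulr_rgt0//; exact: secM.
- by move=> x; exact: secM.
move=> x y.
have := IH M (xsection A x) (xsection B y) (xsection C (x - y : R))
  (measurable_xsection _ mA) (measurable_xsection _ mB) (measurable_xsection _ mC).
rewrite -[vol m (xsection A x)]fineK ?fin// -[vol m (xsection B y)]fineK ?fin//.
rewrite -[vol m (xsection C _)]fineK ?fin// -!EFinM lee_fin -/(sec A x) -/(sec B y).
rewrite -/(sec C (x - y : R)) -mulrA expr2; apply.
- by move=> u; rewrite /xsection/= inE => Du i im; exact: (AM _ Du i.+1).
- by move=> u; rewrite /xsection/= inE => Du i im; exact: (BM _ Du i.+1).
- by move=> u; rewrite /xsection/= inE => Du i im; exact: (CM _ Du i.+1).
- move=> u v; rewrite /xsection/= !inE => Au Bv; exact: (ABC _ _ Au Bv).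
Qed.

End BM.

(** * Affine changes of variables *)

Section Scale.
Variable R : realType.
Local Notation mu := (@lebesgue_measure R).

Lemma integralZ d (X : measurableType d) (m : {measure set X -> \bar R}) (k : R)
    (f : X -> R) : 0 <= k -> measurable_fun setT f -> (forall x, 0 <= f x) ->
  (\int[m]_x (k%:E * (f x)%:E) = k%:E * \int[m]_x (f x)%:E)%E.
Proof.
move=> k0 mf f0; rewrite ge0_integralZl_EFin//; last exact/measurable_EFinP.
by move=> x _; rewrite lee_fin.
Qed.

Lemma integral_affine (l b : R) (f : measurableTypeR R -> \bar R) : l != 0 ->
  measurable_fun setT f -> (forall x, 0 <= f x)%E ->
  (\int[mu]_x f (l * x + b)%R = `|l|^-1%:E * \int[mu]_x f x)%E.
Proof.
move=> l0 mf f0.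
have l1 : 0 <= `|l|^-1 :> R by rewrite invr_ge0.
pose g : measurableTypeR R -> measurableTypeR R := fun x => l * x + b.
have mg : measurable_fun setT g := measurable_affine l b.
rewrite -[LHS]/(\int[mu]_(x in g @^-1` setT) (f \o g) x)%E.
rewrite -ge0_integral_pushforward//.
have := @ge0_integral_mscale _ _ _ mu _ measurableT (NngNum l1) f mf (fun x _ => f0 x).
move=> /= <-; apply: eq_measure_integral => A mA _.
by rewrite /= /mscale/= -(lebesgue_measure_affine b).
Qed.

Lemma vol_affine m (l : R) (b : nat -> R) (A : set (Rpow R m)) : l != 0 -> measurable A ->
  vol m ((fun u => of_coords m (fun i => l * coords u i + b i)) @^-1` A) =
  ((`|l|^-1 ^+ m)%:E * vol m A)%E.
Proof.
move=> l0; elim: m b A => [|m IH] b A mA.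
  by rewrite expr0 mul1e (_ : _ @^-1` A = A)//; apply/seteqP; split => -[].
rewrite !volS.
transitivity (\int[mu]_x ((`|l|^-1 ^+ m)%:E *
  (vol m \o xsection A) (l * x + b 0%N)%R))%E.
  apply: eq_integral => x _ /=.
  rewrite -(IH (fun i => b i.+1)); last exact: measurable_xsection.
  congr (vol m _); apply/seteqP; split => u; rewrite /xsection/= !inE //=.
have mv := measurable_fun_xsection (vol m) mA.
have k0 : 0 <= `|l|^-1 ^+ m by rewrite exprn_ge0// invr_ge0.
rewrite (integral_affine _ (f := fun x => ((`|l|^-1 ^+ m)%:E *
  (vol m \o xsection A) x)%E))//.
- rewrite ge0_integralZl_EFin//.
  by rewrite muleA -EFinM exprS.
- exact: measurable_funeM.
- by move=> x; rewrite mule_ge0.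
Qed.

End Scale.

(** * Volume of ellipsoids *)

Section Gauss.
Variable R : realType.
Local Notation mu := (@lebesgue_measure R).

Lemma gauss_quadratic (l b c : R) : 0 <= l ->
  (\int[mu]_x (expR (- (x ^+ 2 + l * (b + c * x) ^+ 2)))%:E =
   (Num.sqrt pi / Num.sqrt (1 + l * c ^+ 2)
     * expR (- (l * b ^+ 2 / (1 + l * c ^+ 2))))%:E)%E.
Proof.
move=> l0; set d := 1 + l * c ^+ 2.
have d0 : 0 < d by rewrite ltr_pwDl// mulr_ge0// sqr_ge0.
set a := Num.sqrt d.
have a0 : 0 < a by rewrite sqrtr_gt0.
have a2 : a ^+ 2 = d by rewrite sqr_sqrtr// ltW.
pose f : measurableTypeR R -> \bar R := fun x =>
  ((expR (- (l * b ^+ 2 / d)))%:E * (gauss_fun x)%:E)%E.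
have mf : measurable_fun setT f.
  by apply: measurable_funeM; apply/measurable_EFinP; exact: measurable_gauss_fun.
(* Completing the square: x^2 + l (b + c x)^2 = (a x + l b c / a)^2 + l b^2 / d. *)
transitivity (\int[mu]_x f (a * x + l * b * c / a)%R)%E.
  apply: eq_integral => x _; rewrite /f -EFinM /gauss_fun -expRD.
  congr ((expR _)%:E).
  have an0 : a != 0 by rewrite gt_eqF.
  have dn0 : d != 0 by rewrite gt_eqF.
  have -> : (a * x + l * b * c / a) ^+ 2 = d * x ^+ 2 + 2 * (l * b * c) * x +
     (l * b * c) ^+ 2 / d by rewrite -a2; field.
  by rewrite /d; field.
rewrite integral_affine ?gt_eqF//; last first.
  by move=> x; rewrite /f -EFinM lee_fin mulr_ge0// expR_ge0.
rewrite integralZ ?expR_ge0//; [|exact: measurable_gauss_fun|exact: gauss_fun_ge0].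
rewrite integralT_gauss -!EFinM gtr0_norm//; congr (_%:E); ring.
Qed.

Definition sumsq m (f : nat -> R) : R := \sum_(i < m) f i ^+ 2.
Definition dotp m (c f : nat -> R) : R := \sum_(i < m) c i * f i.

Lemma measurable_sumsq m : measurable_fun setT (fun u : Rpow R m => sumsq m (coords u)).
Proof.
rewrite /sumsq; apply: measurable_sum => i; apply: measurable_funX; exact: measurable_coords.
Qed.

Lemma measurable_dotp m c : measurable_fun setT (fun u : Rpow R m => dotp m c (coords u)).
Proof.
rewrite /dotp; apply: measurable_sum => i.
apply: measurable_funM => //; exact: measurable_coords.
Qed.

(** The parameters [l] and [b] make the statement inductive: at a fixed first coordinate x,
    integrating out the others leaves an integrand of the same form, with [b + c 0 * x] for [b] and
    l / (1 + l S) for [l], where S is the sum of the squares of the other coefficients. *)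
Lemma gauss_quadratic_vol m (l b : R) (c : nat -> R) : 0 <= l ->
  (\int[vol m]_u (expR (- (sumsq m (coords u) + l * (b + dotp m c (coords u)) ^+ 2)))%:E =
   (Num.sqrt pi ^+ m / Num.sqrt (1 + l * sumsq m c)
     * expR (- (l * b ^+ 2 / (1 + l * sumsq m c))))%:E)%E.
Proof.
elim: m l b c => [|m IH] l b c l0.
  rewrite integral_dirac//= diracT mul1e /sumsq /dotp !big_ord0 mulr0 !addr0 expr0.
  by rewrite sqrtr1 divr1 mul1r add0r divr1.
pose f : Rpow R m.+1 -> \bar R := fun u =>
  (expR (- (sumsq m.+1 (coords u) + l * (b + dotp m.+1 c (coords u)) ^+ 2)))%:E.
rewrite -[LHS]/(\int[(mu \x vol m)%E]_u f u)%E.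
have mf : measurable_fun setT f.
  apply/measurable_EFinP; apply: measurableT_comp => //; apply: measurableT_comp => //.
  apply: measurable_funD; first exact: (@measurable_sumsq m.+1).
  apply: measurable_funM => //; apply: measurable_funX.
  apply: measurable_funD => //; exact: (@measurable_dotp m.+1).
rewrite (fubini_tonelli1 f mf); last by move=> z; rewrite lee_fin expR_ge0.
set S := sumsq m (fun i => c i.+1).
have S0 : 0 <= S by apply: sumr_ge0 => i _; exact: sqr_ge0.
have ScE : sumsq m.+1 c = c 0%N ^+ 2 + S by rewrite /sumsq big_ord_recl.
have d0 : 0 < 1 + l * S by rewrite ltr_pwDl// mulr_ge0.
pose l' := l / (1 + l * S).
have l'0 : 0 <= l' by rewrite divr_ge0// ltW.
pose A := Num.sqrt pi ^+ m / Num.sqrt (1 + l * S).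
have A0 : 0 <= A by rewrite divr_ge0// exprn_ge0.
transitivity (\int[mu]_x (A%:E * (expR (- (x ^+ 2 + l' * (b + c 0%N * x) ^+ 2)))%:E))%E.
  apply: eq_integral => x _; rewrite /fubini_F/=.
  transitivity (\int[vol m]_u ((expR (- x ^+ 2))%:E * (expR (- (sumsq m (coords u) + l *
     ((b + c 0%N * x) + dotp m (fun i => c i.+1) (coords u)) ^+ 2)))%:E))%E.
    apply: eq_integral => u _; rewrite /f -EFinM -expRD; congr ((expR _)%:E).
    rewrite /sumsq /dotp !big_ord_recl /=; ring.
  rewrite integralZ ?expR_ge0//; last first.
    apply: measurableT_comp => //; apply: measurableT_comp => //.
    apply: measurable_funD; first exact: measurable_sumsq.
    apply: measurable_funM => //; apply: measurable_funX.
    by apply: measurable_funD => //; exact: measurable_dotp.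
  rewrite IH// -!EFinM; congr (_%:E).
  rewrite mulrCA -expRD; congr (_ * expR _); rewrite /l'; ring.
rewrite integralZ//; last first.
  apply: measurableT_comp => //; apply: measurableT_comp => //.
  apply: measurable_funD; first exact: measurable_funX.
  apply: measurable_funM => //; apply: measurable_funX.
  by apply: measurable_funD => //; exact: measurable_funM.
rewrite gauss_quadratic// -EFinM ScE.
have dE : 1 + l * (c 0%N ^+ 2 + S) = (1 + l * S) * (1 + l' * c 0%N ^+ 2).
  by rewrite /l'; field; rewrite gt_eqF.
have e0 : 0 < 1 + l' * c 0%N ^+ 2 by rewrite ltr_pwDl// mulr_ge0// sqr_ge0.
rewrite dE sqrtrM ?(ltW d0)// mulrA; congr ((_ * expR (- _))%:E).
  have := e0; rewrite -sqrtr_gt0; have := d0; rewrite -sqrtr_gt0.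
  rewrite /A (exprS _ m).
  move: (Num.sqrt pi) (Num.sqrt _) (Num.sqrt _) => p x y x0 y0.
  by field; rewrite !gt_eqF.
have {}d0 := lt0r_neq0 d0; have {}e0 := lt0r_neq0 e0.
rewrite {1}/l'; field; exact/andP.
Qed.

End Gauss.

(** * Gaussian moments and the constants [ball_vol] *)

Section BallVolume.
Variable R : realType.
Local Notation mu := (@lebesgue_measure R).

Lemma integral_pow (k : nat) (r : R) : 0 <= r ->
  (\int[mu]_(p in `]0%R, r[) (k.+1%:R * p ^+ k)%:E = (r ^+ k.+1)%:E)%E.
Proof.
rewrite le_eqVlt => /predU1P[<-|r0].
  rewrite (_ : [set` _] = set0) ?integral_set0 ?expr0n//.
  by apply/seteqP; split => x //=; rewrite in_itv/= => /andP[/lt_trans h /h]; rewrite ltxx.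
have cf : continuous (fun p : R => k.+1%:R * p ^+ k).
  by move=> p; apply: cvgM; [exact: cvg_cst|exact: exprn_continuous].
have mf (D : set R) : measurable D -> measurable_fun D (fun p : R => (k.+1%:R * p ^+ k)%:E).
  move=> mD; apply/measurable_EFinP; apply: measurable_funTS.
  by apply: measurable_funM => //; exact: measurable_funX.
rewrite integral_itv_obnd_cbnd; last exact: mf.
rewrite integral_itv_bndo_bndc; last exact: mf.
have dX (x : R) : is_derive x 1 (fun p : R => p ^+ k.+1) (k.+1%:R * x ^+ k).
  apply: DeriveDef; first exact: exprn_derivable.
  by rewrite exp_derive /= [LHS]mulr1.
rewrite (@continuous_FTC2 _ _ (fun p : R => p ^+ k.+1))//.
- by rewrite expr0n/= sube0.
- by apply: continuous_subspaceT.
- split => //.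
  + by apply: cvg_at_right_filter; exact: exprn_continuous.
  + by apply: cvg_at_left_filter; exact: exprn_continuous.
- by move=> x _; rewrite derive1E; exact: derive_val.
Qed.

Lemma gauss_tail (a : R) : 0 <= a ->
  (\int[mu]_(r in `]a, +oo[) (2 * r * expR (- r ^+ 2))%:E = (expR (- a ^+ 2))%:E)%E.
Proof.
move=> a0.
have cf : continuous (fun r : R => 2 * r * expR (- r ^+ 2)).
  move=> r; apply: cvgM; last exact: continuous_gauss_fun.
  by apply: cvgM; [exact: cvg_cst|exact: cvg_id].
have mf (D : set R) : measurable D -> measurable_fun D (fun r : R => (2 * r * expR (- r ^+ 2))%:E).
  move=> mD; apply/measurable_EFinP; apply: measurable_funTS.
  apply: measurable_funM; first exact: measurable_funM.
  exact: measurable_gauss_fun.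
have dX (x : R) : is_derive x 1 (fun r : R => - expR (- r ^+ 2)) (2 * x * expR (- x ^+ 2)).
  have h : is_derive x 1 (fun r : R => r ^+ 2) (2 * x).
    apply: DeriveDef; first exact: exprn_derivable.
    by rewrite exp_derive /= [LHS]mulr1.
  have h2 := is_deriveN (@is_derive1_comp _ expR (fun r : R => - r ^+ 2) x _ _
    (is_derive_expR (- x ^+ 2)) (is_deriveN h)).
  have E : - (expR (- x ^+ 2) * - (2 * x)) = 2 * x * expR (- x ^+ 2) by ring.
  by rewrite -E; exact: h2.
rewrite integral_itv_obnd_cbnd; last exact: mf.
rewrite (@ge0_continuous_FTC2y _ _ (fun r : R => - expR (- r ^+ 2)) _ 0)//.
- by rewrite -EFinB sub0r opprK.
- by move=> x ax; rewrite mulr_ge0 ?expR_ge0// mulr_ge0// (le_trans a0).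
- by apply: continuous_subspaceT.
- by rewrite -oppr0; apply: cvgN; exact: cvg_gauss_fun.
- by apply: cvg_at_right_filter; apply: cvgN; exact: continuous_gauss_fun.
- by move=> x _; rewrite derive1E; exact: derive_val.
Qed.

(** Takes the place of integration by parts on the half-line: both sides integrate f(p) g(r) over 0
    < p < r. *)
Lemma tonelli_triangle (f g : R -> R) :
  measurable_fun setT f -> measurable_fun setT g ->
  (forall x, 0 < x -> 0 <= f x) -> (forall x, 0 < x -> 0 <= g x) ->
  (\int[mu]_(r in `]0%R, +oo[) ((g r)%:E * \int[mu]_(p in `]0%R, r[) (f p)%:E) =
   \int[mu]_(p in `]0%R, +oo[) ((f p)%:E * \int[mu]_(r in `]p, +oo[) (g r)%:E))%E.
Proof.
move=> mf mg f0 g0.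
pose P := [set z : measurableTypeR R * measurableTypeR R |
  0 < (z.2 : R)] `&` [set z | (z.2 : R) < z.1].
have mP : measurable P.
  have m1 : measurable_fun setT (fun z : measurableTypeR R * measurableTypeR R => z.1 : R).
    exact: measurable_fst.
  have m2 : measurable_fun setT (fun z : measurableTypeR R * measurableTypeR R => z.2 : R).
    exact: measurable_snd.
  by apply: measurableI; apply: measurable_lt_set.
pose h := fun z : measurableTypeR R * measurableTypeR R =>
  (\1_P z * (f z.2 * g z.1))%:E.
have mh : measurable_fun setT h.
  apply/measurable_EFinP; apply: measurable_funM; first exact: measurable_indic.
  apply: measurable_funM.
    by apply: (measurableT_comp mf); exact: measurable_snd.
  by apply: (measurableT_comp mg); exact: measurable_fst.
have h0 z : (0 <= h z)%E.
  rewrite lee_fin indicE; case: (boolP (z \in P)) => [|_]; last by rewrite mul0r.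
  rewrite inE => -[/= z2 z21]; rewrite mul1r mulr_ge0 ?f0 ?g0//.
  exact: lt_trans z21.
have := fubini_tonelli (m1 := mu) (m2 := mu) h mh h0.
have -> : (\int[mu]_x \int[mu]_y h (x, y) = \int[mu]_(r in `]0%R, +oo[)
    ((g r)%:E * \int[mu]_(p in `]0%R, r[) (f p)%:E))%E.
  rewrite [RHS]integral_mkcond; apply: eq_integral => r _.
  rewrite patchE mem_setE in_itv/= andbT; case: ifPn => r0.
    rewrite -ge0_integralZl_EFin//; last 3 first.
    - by move=> p /=; rewrite in_itv/= => /andP[p0 _]; rewrite lee_fin f0.
    - by apply: measurable_funTS; exact/measurable_EFinP.
    - exact: g0.
    rewrite [RHS]integral_mkcond; apply: eq_integral => p _.
    rewrite patchE mem_setE in_itv/= /h indicE /P.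
    case: ifPn => pr; first by rewrite mem_set ?mul1r -?EFinM 1?mulrC//=; exact/andP.
    by rewrite memNset ?mul0r//= => -[] ? ?; move/negP: pr; apply; exact/andP.
  apply: integral0_eq => p _; rewrite /h indicE memNset ?mul0r//= => -[/= p0 pr].
  by move/negP: r0; apply; exact: lt_trans pr.
have -> // : (\int[mu]_y \int[mu]_x h (x, y) = \int[mu]_(p in `]0%R, +oo[)
    ((f p)%:E * \int[mu]_(r in `]p, +oo[) (g r)%:E))%E.
rewrite [RHS]integral_mkcond; apply: eq_integral => p _.
rewrite patchE mem_setE in_itv/= andbT; case: ifPn => p0.
  rewrite -ge0_integralZl_EFin//; last 3 first.
  - move=> r /=; rewrite in_itv/= andbT => pr; rewrite lee_fin g0//; exact: lt_trans pr.
  - by apply: measurable_funTS; exact/measurable_EFinP.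
  - exact: f0.
  rewrite [RHS]integral_mkcond; apply: eq_integral => r _.
  rewrite patchE mem_setE in_itv/= andbT /h indicE /P.
  case: ifPn => pr; first by rewrite mem_set ?mul1r -?EFinM//=.
  by rewrite memNset ?mul0r//= => -[] ? ?; move/negP: pr; apply.
apply: integral0_eq => r _; rewrite /h indicE memNset ?mul0r//= => -[/= p1 pr].
by move/negP: p0; apply.
Qed.

(** The substitution of r^2 shows that this is Gamma (m / 2 + 1). *)
Definition gauss_moment m : \bar R :=
  (\int[mu]_(r in `]0%R, +oo[) (r ^+ m * (2 * r * expR (- r ^+ 2)))%:E)%E.

Lemma gauss_moment0 : gauss_moment 0 = 1%E.
Proof.
rewrite /gauss_moment; under eq_integral do rewrite expr0 mul1r.
by rewrite gauss_tail// expr0n/= oppr0 expR0.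
Qed.

Lemma gauss_momentS k : gauss_moment k.+1 =
  (\int[mu]_(p in `]0%R, +oo[) (k.+1%:R * p ^+ k * expR (- p ^+ 2))%:E)%E.
Proof.
transitivity (\int[mu]_(r in `]0%R, +oo[) ((2 * r * expR (- r ^+ 2))%:E *
   \int[mu]_(p in `]0%R, r[) (k.+1%:R * p ^+ k)%:E))%E.
  apply: eq_integral => r; rewrite inE/= in_itv/= andbT => r0.
  by rewrite integral_pow ?ltW// -EFinM mulrC.
rewrite (tonelli_triangle (f := fun p : R => k.+1%:R * p ^+ k)
  (g := fun r : R => 2 * r * expR (- r ^+ 2))).
- apply: eq_integral => p; rewrite inE/= in_itv/= andbT => p0.
  by rewrite gauss_tail ?ltW// -EFinM.
- by apply: measurable_funM => //; exact: measurable_funX.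
- apply: measurable_funM; first exact: measurable_funM.
  exact: measurable_gauss_fun.
- by move=> x x0; rewrite mulr_ge0// exprn_ge0// ltW.
- by move=> x x0; rewrite !mulr_ge0 ?expR_ge0// ltW.
Qed.

Lemma gauss_moment1 : gauss_moment 1 = (Num.sqrt pi / 2)%:E.
Proof.
rewrite gauss_momentS -integral0y_gauss integral_itv_obnd_cbnd; last first.
  apply: measurable_funTS; apply/measurable_EFinP; apply: measurable_funM.
    by apply: measurable_funM => //; exact: measurable_funX.
  exact: measurable_gauss_fun.
by apply: eq_integral => p _; rewrite expr0 !mul1r.
Qed.

Lemma gauss_momentSS m : gauss_moment m.+2 = ((m.+2%:R / 2)%:E * gauss_moment m)%E.
Proof.
rewrite gauss_momentS /gauss_moment -ge0_integralZl_EFin//.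
- apply: eq_integral => p _; rewrite -EFinM; congr (_%:E).
  by rewrite exprS; field.
- move=> x /=; rewrite in_itv/= andbT => x0; rewrite lee_fin !mulr_ge0 ?expR_ge0 ?exprn_ge0 ?ltW//.
- apply: measurable_funTS; apply/measurable_EFinP; apply: measurable_funM.
    exact: measurable_funX.
  apply: measurable_funM; first exact: measurable_funM.
  exact: measurable_gauss_fun.
Qed.

Lemma ball_vol_gt0 m : 0 < ball_vol R m.
Proof.
suff : 0 < ball_vol R m /\ 0 < ball_vol R m.+1 by case.
elim: m => [|m [h1 h2]]; first by split.
split=> //=; rewrite mulr_gt0// divr_gt0 ?mulr_gt0 ?pi_gt0//.
Qed.

(** Identifies [ball_vol] with pi^(m/2) / Gamma (m / 2 + 1). Both recursions go by steps of two,
    hence the pair of consecutive cases in the induction. *)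
Lemma ball_vol_moment m : ((ball_vol R m)%:E * gauss_moment m = (Num.sqrt pi ^+ m)%:E)%E.
Proof.
suff : ((ball_vol R m)%:E * gauss_moment m = (Num.sqrt pi ^+ m)%:E)%E /\
  ((ball_vol R m.+1)%:E * gauss_moment m.+1 = (Num.sqrt pi ^+ m.+1)%:E)%E by case.
elim: m => [|m [h1 h2]]; split => //.
- by rewrite gauss_moment0 mule1.
- by rewrite gauss_moment1 -EFinM; congr (_%:E); rewrite /= expr1; field.
- rewrite gauss_momentSS.
  rewrite (_ : ball_vol R m.+2 = 2 * pi / m.+2%:R * ball_vol R m)//.
  rewrite EFinM -muleA [X in (_ * X)%E]muleCA h1 -!EFinM; congr (_%:E).
  rewrite (_ : _ ^+ m.+2 = Num.sqrt pi ^+ 2 * Num.sqrt pi ^+ m); last by rewrite -exprD.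
  by rewrite sqr_sqrtr ?pi_ge0//; field; rewrite gt_eqF//; have := ler0n R m; lra.
Qed.

End BallVolume.

Section Ellipsoid.
Variable R : realType.
Local Notation mu := (@lebesgue_measure R).
Variables (m : nat) (c : nat -> R).

Definition qform (f : nat -> R) : R := sumsq m f + dotp m c f ^+ 2.

Lemma eq_qform (f g : nat -> R) : (forall i, (i < m)%N -> f i = g i) -> qform f = qform g.
Proof.
move=> fg; rewrite /qform /sumsq /dotp; congr (_ + _ ^+ 2).
  by apply: eq_bigr => i _; rewrite fg.
by apply: eq_bigr => i _; rewrite fg.
Qed.

Lemma qformZ (a : R) f : qform (fun i => a * f i) = a ^+ 2 * qform f.
Proof.
rewrite /qform /sumsq /dotp.
have -> : \sum_(i < m) c i * (a * f i) = a * \sum_(i < m) c i * f i.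
  by rewrite mulr_sumr; apply: eq_bigr => i _; ring.
have -> : \sum_(i < m) (a * f i) ^+ 2 = a ^+ 2 * \sum_(i < m) f i ^+ 2.
  by rewrite mulr_sumr; apply: eq_bigr => i _; ring.
by ring.
Qed.

Lemma qform_ge0 f : 0 <= qform f.
Proof. by rewrite addr_ge0 ?sqr_ge0//; apply: sumr_ge0 => i _; exact: sqr_ge0. Qed.

Lemma qform_coord f i : (i < m)%N -> f i ^+ 2 <= qform f.
Proof.
move=> im; rewrite /qform /sumsq (bigD1 (Ordinal im))//= -addrA lerDl.
by rewrite addr_ge0 ?sqr_ge0//; apply: sumr_ge0 => j _; exact: sqr_ge0.
Qed.

Lemma measurable_qform : measurable_fun setT (fun u : Rpow R m => qform (coords u)).
Proof.
apply: measurable_funD; first exact: measurable_sumsq.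
apply: measurable_funX; exact: measurable_dotp.
Qed.

Definition ellipsoid (r : R) : set (Rpow R m) := [set u | qform (coords u) < r ^+ 2].

Lemma measurable_ellipsoid r : measurable (ellipsoid r).
Proof. apply: measurable_lt_set => //; exact: measurable_qform. Qed.

Lemma ellipsoid_scale r : 0 < r ->
  vol m (ellipsoid r) = ((r ^+ m)%:E * vol m (ellipsoid 1))%E.
Proof.
move=> r0; have rV0 : r^-1 != 0 by rewrite invr_eq0 gt_eqF.
have := vol_affine (fun=> 0) rV0 (measurable_ellipsoid 1).
rewrite gtr0_norm ?invr_gt0// invrK => <-; congr (vol m _).
apply/seteqP; split => u; rewrite /ellipsoid/= (@eq_qform (coords (of_coords m _)) (fun i => r^-1 * coords u i)).
- by rewrite qformZ exprVn ltr_pdivrMl ?exprn_gt0// expr1n mulr1.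
- by move=> i im; rewrite coords_of_coords// addr0.
- by rewrite qformZ exprVn ltr_pdivrMl ?exprn_gt0// expr1n mulr1.
- by move=> i im; rewrite coords_of_coords// addr0.
Qed.

(** Write exp (- q) as the integral of 2 r exp (- r^2) over r > sqrt q and exchange the integrals:
    for fixed r the points with q < r^2 form an ellipsoid, whose volume is r^m times that of the
    unit one. The other evaluation is [gauss_quadratic_vol]. *)
Lemma ellipsoid_moment :
  (vol m (ellipsoid 1) * gauss_moment R m = (Num.sqrt pi ^+ m / Num.sqrt (1 + sumsq m c))%:E)%E.
Proof.
have := gauss_quadratic_vol m 0 c (ler01 : 0 <= 1 :> R).
rewrite expr0n/= mulr0 mul0r oppr0 expR0 mulr1 mul1r => <-.
pose g r : R := 2 * r * expR (- r ^+ 2).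
have mg : measurable_fun setT g.
  apply: measurable_funM; first exact: measurable_funM.
  exact: measurable_gauss_fun.
have g0 r : 0 < r -> 0 <= g r by move=> r0; rewrite !mulr_ge0 ?expR_ge0// ltW.
pose P := [set z : Rpow R m * measurableTypeR R |
  0 < (z.2 : R)] `&` [set z | qform (coords z.1) < (z.2 : R) ^+ 2].
have m2 : measurable_fun setT (fun z : Rpow R m * measurableTypeR R => z.2 : R).
  exact: measurable_snd.
have mP : measurable P.
  apply: measurableI; apply: measurable_lt_set => //.
    by apply: (measurableT_comp measurable_qform); exact: measurable_fst.
  exact: measurable_funX.
pose h := fun z : Rpow R m * measurableTypeR R => (\1_P z * g z.2)%:E.
have mh : measurable_fun setT h.
  apply/measurable_EFinP; apply: measurable_funM; first exact: measurable_indic.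
  exact: (measurableT_comp mg).
have h0 z : (0 <= h z)%E.
  rewrite lee_fin indicE; case: (boolP (z \in P)) => [|_]; last by rewrite mul0r.
  by rewrite inE => -[/= z2 z21]; rewrite mul1r g0.
have := fubini_tonelli (m1 := vol m) (m2 := mu) h mh h0.
have -> : (\int[vol m]_x \int[mu]_y h (x, y) = \int[vol m]_u
   (expR (- (sumsq m (coords u) + 1 * (0 + dotp m c (coords u)) ^+ 2)))%:E)%E.
  apply: eq_integral => u _; rewrite mul1r add0r -/(qform (coords u)).
  have sn0 : 0 <= Num.sqrt (qform (coords u)) by [].
  rewrite -[X in expR (- X)](sqr_sqrtr (qform_ge0 _)) -(gauss_tail sn0).
  rewrite [RHS]integral_mkcond; apply: eq_integral => r _.
  rewrite patchE mem_setE in_itv/= andbT /h indicE /P.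
  case: ifPn => ur.
    have r0 : 0 < r by exact: le_lt_trans ur.
    rewrite mem_set ?mul1r//=; split => //=.
    by rewrite -[X in X < _](sqr_sqrtr (qform_ge0 _)) ltr_pXn2r// nnegrE// ltW.
  rewrite memNset ?mul0r// => -[/= r0 ur2]; move/negP: ur; apply.
  by rewrite -(@ltr_pXn2r _ 2)// ?nnegrE// ?ltW// sqr_sqrtr// qform_ge0.
move=> ->; rewrite muleC.
have [K KP] := vol_bounded (R := R) m 1.
have Vfin : vol m (ellipsoid 1) \is a fin_num.
  rewrite ge0_fin_numE//; apply: le_lt_trans (ltry K); apply: KP.
    exact: measurable_ellipsoid.
  move=> u; rewrite /ellipsoid/= expr1n => u1 i im.
  have := le_lt_trans (qform_coord (coords u) im) u1.
  by rewrite -real_normK ?num_real// -[X in _ < X](expr1n _ 2) ltr_pXn2r ?nnegrE// => /ltW.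
rewrite -(fineK Vfin); set V := fine _.
have V0 : 0 <= V by rewrite fine_ge0.
rewrite muleC /gauss_moment -ge0_integralZl_EFin//; last 2 first.
- by move=> r /=; rewrite in_itv/= andbT => r0; rewrite lee_fin mulr_ge0 ?g0 ?exprn_ge0 ?ltW.
- apply: measurable_funTS; apply/measurable_EFinP; by apply: measurable_funM.
rewrite [LHS]integral_mkcond; apply: eq_integral => r _.
rewrite patchE mem_setE in_itv/= andbT; case: ifPn => r0.
  transitivity (\int[vol m]_u ((g r)%:E * (\1_(ellipsoid r) u)%:E))%E; last first.
    apply: eq_integral => u _; rewrite /h -EFinM mulrC !indicE.
    have -> // : ((u, r) \in P) = (u \in ellipsoid r).
    apply/idP/idP; first by rewrite !inE => -[].
    by rewrite !inE => ?; split.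
  rewrite integralZ ?g0//; last first.
    exact/measurable_indic/measurable_ellipsoid.
  rewrite integral_indic//= ?setIT//; last exact: measurable_ellipsoid.
  by rewrite ellipsoid_scale// -(fineK Vfin) -/V -!EFinM; congr (_%:E); rewrite /g; ring.
rewrite integral0_eq// => u _; rewrite /h indicE memNset ?mul0r//= => -[/= p1 _].
by move/negP: r0; apply.
Qed.

Lemma vol_ellipsoid r : 0 < r ->
  vol m (ellipsoid r) = (r ^+ m * (ball_vol R m / Num.sqrt (1 + sumsq m c)))%:E.
Proof.
move=> r0; rewrite ellipsoid_scale// EFinM; congr (_ * _)%E.
have := ellipsoid_moment; have := ball_vol_moment R m.
have b0 := ball_vol_gt0 R m.
have sp : 0 < Num.sqrt pi ^+ m :> R by rewrite exprn_gt0// sqrtr_gt0 pi_gt0.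
set s := Num.sqrt (1 + _).
have s0 : 0 < s.
  rewrite sqrtr_gt0 ltr_pwDl//; by apply: sumr_ge0 => i _; exact: sqr_ge0.
have gm0 : (0 <= gauss_moment R m)%E.
  apply: integral_ge0 => r1 /=; rewrite in_itv/= andbT => r10.
  by rewrite lee_fin !mulr_ge0 ?expR_ge0 ?exprn_ge0 ?ltW.
case: (gauss_moment R m) gm0 => [g|_|//]; last by rewrite gt0_muley ?lte_fin.
rewrite lee_fin => g0; rewrite -EFinM => -[bg].
have {}g0 : 0 < g by rewrite -(pmulr_rgt0 _ b0) bg.
have V0 : (0 <= vol m (ellipsoid 1))%E by [].
case: (vol m (ellipsoid 1)) V0 => [V _|_|//]; last by rewrite gt0_mulye ?lte_fin.
rewrite -EFinM -bg => -[Vg]; congr (_%:E).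
have gn0 : g != 0 by rewrite gt_eqF.
apply: (mulIf gn0); rewrite Vg; ring.
Qed.

End Ellipsoid.

(** * Isodiametric inequality *)

Section Isodiametric.
Variable R : realType.
Variables (m : nat) (c : nat -> R).
Local Notation q := (qform m c).
Local Notation ell := (@ellipsoid R m c).
(** The quantity under the root is the determinant of I + c c^T, the Gram matrix of [qform]. *)
Definition ellipsoid_vol : R := ball_vol R m / Num.sqrt (1 + sumsq m c).

Lemma det_gt0 : 0 < 1 + sumsq m c.
Proof. by rewrite ltr_pwDl//; apply: sumr_ge0 => i _; exact: sqr_ge0. Qed.

Lemma ellipsoid_vol_gt0 : 0 < ellipsoid_vol.
Proof. by rewrite divr_gt0 ?ball_vol_gt0// sqrtr_gt0 det_gt0. Qed.

(** The triangle inequality for the norm sqrt q, stated without roots. The bound on the mixed term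
    comes from q (b f - a g) >= 0. *)
Lemma qformD (a b : R) f g : 0 < a -> 0 < b -> q f <= a ^+ 2 -> q g <= b ^+ 2 ->
  q (fun i => f i + g i) <= (a + b) ^+ 2.
Proof.
move=> a0 b0 fa gb.
pose P := \sum_(i < m) f i * g i + dotp m c f * dotp m c g.
have E x y : q (fun i => x * f i + y * g i) =
    x ^+ 2 * q f + 2 * x * y * P + y ^+ 2 * q g.
  rewrite /qform /P /sumsq /dotp.
  have -> : \sum_(i < m) c i * (x * f i + y * g i) =
      x * (\sum_(i < m) c i * f i) + y * (\sum_(i < m) c i * g i).
    by rewrite !mulr_sumr -big_split/=; apply: eq_bigr => i _; ring.
  have -> : \sum_(i < m) (x * f i + y * g i) ^+ 2 = x ^+ 2 * (\sum_(i < m) f i ^+ 2) +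
      2 * x * y * (\sum_(i < m) f i * g i) + y ^+ 2 * (\sum_(i < m) g i ^+ 2).
    by rewrite !mulr_sumr -!big_split/=; apply: eq_bigr => i _; ring.
  by ring.
have -> : q (fun i => f i + g i) = q f + 2 * P + q g.
  have := E 1 1; rewrite !expr1n !mul1r !mulr1 => <-.
  by apply: eq_qform => i _; rewrite !mul1r.
have := qform_ge0 m c (fun i => b * f i + - a * g i); rewrite E => h.
have ab : 0 < a * b by rewrite mulr_gt0.
have h2 : a * b * P <= a * b * (a * b).
  have h3 : b ^+ 2 * q f <= b ^+ 2 * a ^+ 2 by rewrite ler_wpM2l// sqr_ge0.
  have h4 : a ^+ 2 * q g <= a ^+ 2 * b ^+ 2 by rewrite ler_wpM2l// sqr_ge0.
  by move: h h3 h4; set u := q f; set v := q g; nra.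
rewrite ler_pM2l// in h2.
by move: fa gb; set u := q f; set v := q g; nra.
Qed.

Definition qform_sup : R := 1 + m%:R + \sum_(i < m) `|c i|.

Lemma qform_sup_gt0 : 0 < qform_sup.
Proof. by rewrite /qform_sup ltr_wpDr ?sumr_ge0// ltr_pwDl. Qed.

Lemma qform_le_sup (e : R) f : (forall i, (i < m)%N -> `|f i| <= e) -> 0 <= e ->
  q f <= (qform_sup * e) ^+ 2.
Proof.
move=> fe e0.
pose S := \sum_(i < m) `|c i|.
have S0 : 0 <= S by rewrite sumr_ge0.
have h1 : sumsq m f <= m%:R * e ^+ 2.
  rewrite /sumsq mulr_natl -[X in _ *+ X](card_ord m) -sumr_const.
  by apply: ler_sum => i _; rewrite -(@real_normK _ (f i)) ?num_real// ler_pXn2r ?nnegrE ?fe.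
have h2 : dotp m c f ^+ 2 <= (S * e) ^+ 2.
  rewrite -(@real_normK _ (dotp _ _ _)) ?num_real// ler_pXn2r ?nnegrE ?mulr_ge0//.
  rewrite /dotp /S mulr_suml; apply: le_trans (ler_norm_sum _ _ _) _.
  by apply: ler_sum => i _; rewrite normrM ler_wpM2l ?fe.
apply: le_trans (lerD h1 h2) _.
rewrite !exprMn -mulrDl ler_wpM2r ?sqr_ge0// /qform_sup -/S.
have m0 : 0 <= m%:R :> R by [].
by move: m0; set M := m%:R => m0; nra.
Qed.

(** A - A lies in the ellipsoid of radius [d], so Brunn-Minkowski for A and A gives 2^m |A| <= |ell
    d|. The diameter condition is strict because the ellipsoid is open. *)
Lemma isodiam_measurable (M d : R) (A : set (Rpow R m)) : 0 < d -> measurable A ->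
  (forall u, A u -> forall i, (i < m)%N -> `|coords u i| <= M) ->
  (forall u v, A u -> A v -> q (fun i => coords u i - coords v i) < d ^+ 2) ->
  (vol m A <= (ellipsoid_vol / 2 ^+ m * d ^+ m)%:E)%E.
Proof.
move=> d0 mA AM Ad.
have Ed u : ell d u -> forall i, (i < m)%N -> `|coords u i| <= d.
  move=> ud i im; have := le_lt_trans (qform_coord c (coords u) im) ud.
  by rewrite -real_normK ?num_real// ltr_pXn2r ?nnegrE// ?(ltW d0)// => /ltW.
have := @brunn_minkowski R m (Num.max M d) A A (ell d) mA mA (@measurable_ellipsoid R m c d).
have [K KP] := vol_bounded (R := R) m M.
have Vfin : vol m A \is a fin_num.
  rewrite ge0_fin_numE//; apply: le_lt_trans (ltry K); exact: KP.
rewrite vol_ellipsoid// -(fineK Vfin) -/ellipsoid_vol; set V := fine _.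
have V0 : 0 <= V by rewrite fine_ge0.
rewrite -!EFinM !lee_fin => h.
have {}h : 4 ^+ m * (V * V) <= (d ^+ m * ellipsoid_vol) * (d ^+ m * ellipsoid_vol).
  apply: h.
  - by move=> u Au i im; rewrite le_max AM.
  - by move=> u Au i im; rewrite le_max AM.
  - by move=> u Au i im; rewrite le_max Ed ?orbT.
  - move=> u v Au Av; rewrite /ellipsoid/=.
    by rewrite (@eq_qform _ _ _ _ (fun i => coords u i - coords v i)) ?Ad// => i im; rewrite coords_of_coords.
have p2 : 0 < 2 ^+ m :> R by rewrite exprn_gt0.
rewrite -(ler_pM2l p2) mulrA (mulrCA (2 ^+ m)) divff ?gt_eqF// mulr1.
have db0 : 0 <= d ^+ m * ellipsoid_vol := mulr_ge0 (exprn_ge0 _ (ltW d0)) (ltW ellipsoid_vol_gt0).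
have dV0 : 0 <= 2 ^+ m * V := mulr_ge0 (ltW p2) V0.
rewrite [ellipsoid_vol * _]mulrC -(@ler_pXn2r _ 2)//.
rewrite !expr2.
have E4 : 4 ^+ m = 2 ^+ m * 2 ^+ m :> R by rewrite -exprMn -natrM.
by apply: le_trans h; rewrite E4 mulrACA.
Qed.

Lemma pow_continuity (K d e : R) : 0 < e -> exists2 h : R, 0 < h & K * (d + h) ^+ m <= K * d ^+ m + e.
Proof.
move=> e0.
have cf : (fun x : R => K * x ^+ m) x @[x --> d] --> K * d ^+ m.
  by apply: cvgM; [exact: cvg_cst|exact: exprn_continuous].
move/cvgrPdist_lt : cf => /(_ _ e0) [h /= h0 hP].
exists (h / 2); first by rewrite divr_gt0.
have : `|d - (d + h / 2)| < h.
  by rewrite opprD addNKr normrN gtr0_norm ?divr_gt0//; lra.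
by move/hP; rewrite distrC => /ltr_distlDr /ltW; rewrite addrC.
Qed.

(** The sets of a Hausdorff cover need not be measurable. Replacing [A] by the union of the cells of
    a fine grid that meet it makes it measurable and hardly increases the diameter; the cells are
    indexed by the countable type [seq int]. *)
Lemma isodiam_outer (d e : R) (A : set (Rpow R m)) : 0 <= d -> 0 < e -> A !=set0 ->
  (forall u v, A u -> A v -> q (fun i => coords u i - coords v i) <= d ^+ 2) ->
  exists B : set (Rpow R m), [/\ measurable B, A `<=` B &
    (vol m B <= (ellipsoid_vol / 2 ^+ m * d ^+ m + e)%:E)%E].
Proof.
move=> d0 e0 [u0 Au0] Ad.
have [h h0 hP] := pow_continuity (ellipsoid_vol / 2 ^+ m) d e0.
(* Moving two points by at most [h'] in every coordinate costs [qform_sup * (2 * h')]. Of the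
   remaining [2 * h'], one half makes [d + h'] positive, as [qformD] requires, and the other makes
   the final inequality strict. *)
pose h' := h / (2 + 2 * qform_sup).
have s0 := qform_sup_gt0.
have h'0 : 0 < h' by rewrite divr_gt0// addr_gt0// mulr_gt0.
have hE : h = h' + h' + 2 * qform_sup * h' by rewrite /h'; field; rewrite gt_eqF//; lra.
pose F (k : seq int) : set (Rpow R m) :=
  let B := box m (fun i => (nth 0 k i)%:~R * h') (fun i => ((nth 0 k i)%:~R + 1) * h') in
  [set u | B u /\ (A `&` B) !=set0].
have mF k : measurable (F k).
  rewrite /F; set B := box _ _ _.
  have [|h1] := pselect ((A `&` B) !=set0).
    move=> h1; rewrite (_ : [set u | _] = B); first exact: measurable_box.
    by apply/seteqP; split => [u []//|u Bu]; split.
  rewrite (_ : [set u | _] = set0)//.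
  by apply/seteqP; split => [u []//|u []].
have AF : A `<=` \bigcup_k F k.
  move=> u Au; pose k := mkseq (fun i => Num.floor (coords u i / h')) m.
  have Bu : box m (fun i => (nth 0 k i)%:~R * h') (fun i => ((nth 0 k i)%:~R + 1) * h') u.
    move=> i im; rewrite /k nth_mkseq// -ler_pdivlMr// -ltr_pdivrMr//.
    by have := floor_itv (coords u i / h'); rewrite intrD.
  by exists k => //; split=> //; exists u.
exists (\bigcup_k F k); split => //.
  by apply: countable_bigcupT_measurable => //; exact: countableP.
have Fnear v : (\bigcup_k F k) v -> exists2 u, A u & forall i, (i < m)%N -> `|coords v i - coords u i| <= h'.
  move=> [k _ [Bv [u [Au Bu]]]]; exists u => // i im.
  have /andP[a1 a2] := Bv _ im; have /andP[b1 b2] := Bu _ im.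
  by rewrite ler_norml; apply/andP; split; lra.
apply: le_trans (_ : (ellipsoid_vol / 2 ^+ m * (d + h) ^+ m)%:E <= _)%E; last by rewrite lee_fin.
have diam v w : (\bigcup_k F k) v -> (\bigcup_k F k) w ->
   q (fun i => coords v i - coords w i) < (d + h) ^+ 2.
  move=> /Fnear[u Au uv] /Fnear[x Ax xw].
  apply: (@le_lt_trans _ _ ((d + h' + qform_sup * (2 * h')) ^+ 2)); last first.
    have sh0 : 0 <= qform_sup * (2 * h') by rewrite mulr_ge0 ?(ltW s0)// mulr_ge0// ltW.
    have lt : d + h' + qform_sup * (2 * h') < d + h.
      have : h = h' + h' + qform_sup * (2 * h') by rewrite hE; ring.
      lra.
    by rewrite ltr_pXn2r ?nnegrE//; lra.
  rewrite (@eq_qform _ _ _ _ (fun i => (coords u i - coords x i) +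
     ((coords v i - coords u i) - (coords w i - coords x i)))); last by move=> i _; ring.
  apply: qformD.
  - by rewrite ltr_wpDl.
  - by rewrite mulr_gt0// mulr_gt0.
  - by apply: (le_trans (Ad _ _ Au Ax)); rewrite ler_pXn2r ?nnegrE ?addr_ge0 ?(ltW h'0)// lerDl ltW.
  - apply: qform_le_sup; last by rewrite mulr_ge0// ltW.
    move=> i im; apply: (le_trans (ler_normB _ _)).
    by have := uv _ im; have := xw _ im; lra.
pose M := d + h + \sum_(i < m) `|coords u0 i|.
apply: (@isodiam_measurable M) => //.
- by rewrite ltr_wpDl.
- by apply: countable_bigcupT_measurable => //; exact: countableP.
- move=> u Fu i im.
  have := le_lt_trans (qform_coord c _ im) (diam u u0 Fu (AF _ Au0)).
  rewrite -real_normK ?num_real// ltr_pXn2r ?nnegrE ?addr_ge0 ?(ltW h0)// => ui.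
  have : `|coords u0 i| <= \sum_(i < m) `|coords u0 i|.
    by rewrite (bigD1 (Ordinal im))//= lerDl sumr_ge0.
  have := ler_normD (coords u i - coords u0 i) (coords u0 i); rewrite subrK /M; lra.
Qed.

(** Empty sets are charged 0 whatever their [d k]. In [perimeter_ge_shrunk] this lets a member of a
    cover be charged only to the facet that it meets. *)
Lemma cover_lower_bound (D : set (Rpow R m)) (A : nat -> set (Rpow R m)) (d : nat -> R) :
  measurable D -> D `<=` \bigcup_k A k ->
  (forall k, 0 <= d k) ->
  (forall k u v, A k u -> A k v -> q (fun i => coords u i - coords v i) <= d k ^+ 2) ->
  (vol m D <= \sum_(0 <= k <oo) (if A k == set0 then 0 else ellipsoid_vol / 2 ^+ m * d k ^+ m)%:E)%E.
Proof.
move=> mD DA d0 Ad.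
pose a k : R := if A k == set0 then 0 else ellipsoid_vol / 2 ^+ m * d k ^+ m.
have a0 k : 0 <= a k.
  rewrite /a; case: ifP => // _.
  by rewrite mulr_ge0 ?exprn_ge0// divr_ge0 ?exprn_ge0// ltW// ellipsoid_vol_gt0.
apply/lee_addgt0Pr => e e0.
have /choice[B BP] : forall k, exists B : set (Rpow R m), [/\ measurable B, A k `<=` B &
    (vol m B <= (a k + (e / (2 ^ k.+1)%:R))%:E)%E].
  move=> k; have ek : 0 < e / (2 ^ k.+1)%:R by rewrite divr_gt0// ltr0n expn_gt0.
  rewrite /a; case: ifPn => [/eqP ->|Ak].
    exists set0; split => //; rewrite measure0 lee_fin addr_ge0// ltW//.
  have /set0P Ak0 := Ak; exact: (isodiam_outer (d0 k) ek Ak0 (Ad k)).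
apply: (@le_trans _ _ (\sum_(0 <= k <oo) vol m (B k))%E).
  apply: measure_sigma_subadditive => //; first by move=> k; have [] := BP k.
  by apply: subset_trans DA _; apply: subset_bigcup => k _; have [] := BP k.
apply: (@le_trans _ _ (\sum_(0 <= k <oo) ((a k)%:E + (e / (2 ^ k.+1)%:R)%:E))%E).
  by apply: lee_nneseries => // k _; rewrite -EFinD; have [] := BP k.
by apply: epsilon_trick => [k|]; [rewrite lee_fin|exact: ltW].
Qed.

End Isodiametric.

(** * Optimal covers of cubes and simplices *)

Section Grid.
Variable R : realType.
Variables (m N : nat).
Local Notation idx := {ffun 'I_m -> 'I_N.+1}.

Definition cell_index (k : idx) (i : nat) : nat :=
  oapp (fun j => nat_of_ord (k j)) 0%N (insub i).

Lemma cell_indexE k (j : 'I_m) : cell_index k j = k j.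
Proof. by rewrite /cell_index valK. Qed.

Definition cell (o h : R) (k : idx) : set (Rpow R m) :=
  box m (fun i => o + h * (cell_index k i)%:R) (fun i => o + h * (cell_index k i).+1%:R).

Lemma cell_cover (o h : R) (f : Rpow R m) : 0 < h ->
  (forall i, (i < m)%N -> o <= coords f i < o + h * N.+1%:R) -> exists k, cell o h k f.
Proof.
move=> h0 fP; pose k : idx := [ffun j : 'I_m => inord (Num.truncn ((coords f j - o) / h))].
exists k => i im; have /andP[f1 f2] := fP i im.
have q0 : 0 <= (coords f i - o) / h by rewrite divr_ge0 ?(ltW h0)// subr_ge0.
have /andP[t1 t2] := truncn_itv q0.
have kE : cell_index k i = Num.truncn ((coords f i - o) / h).
  rewrite -[i]/(nat_of_ord (Ordinal im)) cell_indexE ffunE inordK//.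
  rewrite -(ltr_nat R); apply: le_lt_trans t1 _.
  by rewrite ltr_pdivrMr// mulrC; lra.
move: t1 t2; rewrite kE ler_pdivlMr// ltr_pdivrMr// ![_ * h]mulrC => t1 t2.
by apply/andP; split; lra.
Qed.

Lemma cell_uniq (o h : R) k k' (f : Rpow R m) : 0 < h ->
  cell o h k f -> cell o h k' f -> k = k'.
Proof.
move=> h0 kf kf'; apply/ffunP => j; apply/val_inj => /=.
have /andP[a1 a2] := kf j (ltn_ord j); have /andP[b1 b2] := kf' j (ltn_ord j).
rewrite !cell_indexE in a1 a2 b1 b2.
have h1 : h * (k j)%:R < h * (k' j).+1%:R by lra.
have h2 : h * (k' j)%:R < h * (k j).+1%:R by lra.
move: h1 h2; rewrite !ltr_pM2l// !ltr_nat !ltnS => h1 h2.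
by apply/eqP; rewrite eqn_leq h1.
Qed.

Lemma vol_cell (o h : R) k : 0 < h -> vol m (cell o h k) = (h ^+ m)%:E.
Proof.
move=> h0; rewrite vol_box; last first.
  by move=> i _; rewrite lerD2l ler_pM2l// ler_nat.
congr (_%:E); rewrite (eq_bigr (fun=> h)) ?prodr_const ?card_ord// => i _.
by rewrite -natr1; ring.
Qed.

Lemma vol_le_cells (o h : R) (S : {set idx}) (A : set (Rpow R m)) : 0 < h ->
  measurable A -> (forall f, A f -> exists2 k, k \in S & cell o h k f) ->
  (vol m A <= (#|S|%:R * h ^+ m)%:E)%E.
Proof.
move=> h0 mA AS.
have [S0|/card_gt0P[k0 k0S]] := posnP #|S|.
  rewrite S0 mul0r (_ : A = set0) ?measure0//.
  apply/seteqP; split => // f /AS[k]; move/eqP: S0; rewrite cards_eq0 => /eqP ->.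
  by rewrite inE.
pose F n := cell o h (nth k0 (enum S) n).
have -> : ((#|S|%:R * h ^+ m)%:E = \sum_(n < #|S|) vol m (F n))%E.
  rewrite (eq_bigr (fun=> (h ^+ m)%:E)); last by move=> i _; rewrite vol_cell.
  by rewrite sumEFin sumr_const card_ord mulr_natl.
apply: content_subadditive => //; first by move=> n _; exact: measurable_box.
move=> f /AS[k kS kf]; rewrite -bigcup_mkord; exists (index k (enum S)) => /=.
  by rewrite cardE index_mem mem_enum.
by rewrite /F nth_index ?mem_enum.
Qed.

Lemma cells_le_vol (o h : R) (S : {set idx}) (A : set (Rpow R m)) : 0 < h ->
  measurable A -> (forall k, k \in S -> cell o h k `<=` A) ->
  ((#|S|%:R * h ^+ m)%:E <= vol m A)%E.
Proof.
move=> h0 mA AS.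
pose F (n : 'I_#|S|) := cell o h (enum_val n).
have -> : ((#|S|%:R * h ^+ m)%:E = \sum_(n < #|S|) vol m (F n))%E.
  rewrite (eq_bigr (fun=> (h ^+ m)%:E)); last by move=> i _; rewrite vol_cell.
  by rewrite sumEFin sumr_const card_ord mulr_natl.
have mF n : measurable (F n) by exact: measurable_box.
have mU : measurable (\big[setU/set0]_(n < #|S|) F n) by exact: bigsetU_measurable.
rewrite -measure_semi_additive_ord//; last first.
  by move=> i j _ _ [f [fi fj]]; apply: enum_val_inj; exact: cell_uniq fi fj.
apply: le_measure; rewrite ?inE//; apply: (big_ind (fun X => X `<=` A)) => //.
  by move=> X Y XA YA f [/XA|/YA].
by move=> i _; exact: AS (enum_valP i).
Qed.

End Grid.

Section Cover.
Variable R : realType.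
Variables (m : nat) (c : nat -> R).
Local Notation q := (qform m c).
Local Notation b := (ellipsoid_vol m c).

(* [qcover dl A C] presents inductively the finite covers of [A] by sets whose diameters
   [d_j] for the norm [sqrt qform] are at most [dl] and satisfy [sum d_j^m <= C]. *)
Inductive qcover (dl : R) : set (Rpow R m) -> R -> Prop :=
| qcover0 : qcover dl set0 0
| qcover1 A d : 0 <= d <= dl ->
    (forall u v, A u -> A v -> q (fun i => coords u i - coords v i) <= d ^+ 2) ->
    qcover dl A (d ^+ m)
| qcoverU A B C D : qcover dl A C -> qcover dl B D -> qcover dl (A `|` B) (C + D)
| qcoverS A B C D : B `<=` A -> C <= D -> qcover dl A C -> qcover dl B D.

Lemma qcover_ge0 dl A C : qcover dl A C -> 0 <= C.
Proof.
elim=> // [A0 d /andP[d0 _] _|A0 B C0 D _ h1 _ h2|A0 B C0 D _ CD _ h1].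
- exact: exprn_ge0.
- exact: addr_ge0.
- exact: le_trans CD.
Qed.

Lemma qcover_affine dl A C l (o : nat -> R) : 0 < l -> qcover dl A C ->
  qcover (l * dl) ((fun u => of_coords m (fun i => l^-1 * (coords u i - o i))) @^-1` A) (l ^+ m * C).
Proof.
move=> l0; elim=> {A C} [|A d /andP[d0 ddl] Ad|A B C D _ h1 _ h2|A B C D BA CD _ h1].
- by rewrite mulr0; exact: qcover0.
- rewrite -exprMn; apply: qcover1; first by rewrite mulr_ge0 ?(ltW l0)//= ler_pM2l.
  move=> u v /= Au Av; have := Ad _ _ Au Av.
  rewrite (@eq_qform _ _ _ _ (fun i => l^-1 * (coords u i - coords v i))).
    by rewrite qformZ exprVn ler_pdivrMl ?exprn_gt0// exprMn.
  by move=> i im; rewrite !coords_of_coords//; ring.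
- rewrite mulrDr preimage_setU; exact: qcoverU.
- by apply: qcoverS h1; [exact: preimage_subset|rewrite ler_pM2l ?exprn_gt0].
Qed.

Lemma qcover_bigU (I : Type) dl (s : seq I) (F : I -> set (Rpow R m)) (C : R) :
  (forall i, qcover dl (F i) C) ->
  qcover dl (\big[setU/set0]_(i <- s) F i) ((size s)%:R * C).
Proof.
move=> FC; elim: s => [|x s IH]; first by rewrite big_nil mul0r; exact: qcover0.
by rewrite big_cons /= -natr1 mulrDl mul1r addrC; exact: qcoverU.
Qed.

Lemma qcover_le dl dl' A C : dl <= dl' -> qcover dl A C -> qcover dl' A C.
Proof.
move=> dd; elim=> [|A0 d /andP[d0 d1] h|A0 B C0 D _ h1 _ h2|A0 B C0 D BA CD _ h].
- exact: qcover0.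
- by apply: qcover1 => //; rewrite d0 (le_trans d1).
- exact: qcoverU.
- exact: qcoverS h.
Qed.

Definition ucube : set (Rpow R m) := box m (fun=> -1) (fun=> 1).

Definition ucube_diam : R := Num.max 2 (qform_sup m c * 2).

Lemma qcover_ucube : qcover ucube_diam ucube ((qform_sup m c * 2) ^+ m).
Proof.
apply: qcover1.
  by rewrite mulr_ge0 ?(ltW (qform_sup_gt0 _ _))//= /ucube_diam le_max lexx orbT.
move=> u v uQ vQ; apply: qform_le_sup => // i im.
have := uQ i im; have := vQ i im; rewrite ler_norml; lra.
Qed.

Lemma qcover_ellipsoid : qcover ucube_diam (@ellipsoid R m c 1) (2 ^+ m).
Proof.
apply: qcover1; first by rewrite /ucube_diam le_max lexx ler0n.
move=> u v uE vE; rewrite [2](_ : _ = 1 + 1); last by [].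
rewrite (@eq_qform _ _ _ _ (fun i => coords u i + (-1 * coords v i))); last by move=> i _; ring.
apply: qformD => //; first exact: ltW.
by have := ltW (vE : q (coords v) < 1 ^+ 2); rewrite qformZ; lra.
Qed.

Lemma qcover_cell N (o h : R) k dl C : 0 < h -> qcover dl ucube C ->
  qcover (h / 2 * dl) (@cell R m N o h k) ((h / 2) ^+ m * C).
Proof.
move=> h0 QC; have h20 : 0 < h / 2 by rewrite divr_gt0.
apply: (qcoverS _ _ (qcover_affine (fun i => o + h * (cell_index k i)%:R + h / 2) h20 QC)) => //.
move=> u uk i im; rewrite coords_of_coords//; have /andP[u1 u2] := uk i im.
move: u2; rewrite -natr1 => u2.
by rewrite ler_pdivlMl// ltr_pdivrMl//; apply/andP; split; lra.
Qed.

Lemma qcover_cells N (o h : R) (S : {set {ffun 'I_m -> 'I_N.+1}}) dl C A : 0 < h ->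
  qcover dl ucube C -> (forall f, A f -> exists2 k, k \in S & cell o h k f) ->
  qcover (h / 2 * dl) A (#|S|%:R * ((h / 2) ^+ m * C)).
Proof.
move=> h0 QC AS.
have := qcover_bigU (enum S) (fun k => qcover_cell (N := N) o k h0 QC).
rewrite -cardE; apply: qcoverS => // f /AS[k kS kf].
by rewrite -bigcup_seq; exists k => //=; rewrite mem_enum.
Qed.

Lemma bernoulli (x : R) : 0 <= x <= 1 -> 1 - m%:R * x <= (1 - x) ^+ m.
Proof.
move=> /andP[x0 x1]; elim: m => [|k IH]; first by rewrite mul0r subr0 expr0.
rewrite exprS; apply: (@le_trans _ _ ((1 - x) * (1 - k%:R * x))); last first.
  by rewrite ler_wpM2l// subr_ge0.
rewrite -natr1; have : 0 <= k%:R * x * x by rewrite !mulr_ge0.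
by lra.
Qed.

(** The unit ellipsoid, of diameter 2, costs [2 ^+ m]. Scaled covers of [ucube] are used only for
    the cells not contained in it, and since [ucube] has volume 2^m, at least the fraction (1 - e)^m
    b / 2^m of the cells is contained in it. *)
Lemma qcover_refine (e C : R) : 0 < e < 1 -> qcover ucube_diam ucube C ->
  qcover ucube_diam ucube (2 ^+ m + (1 - (1 - e) ^+ m * b / 2 ^+ m) * C).
Proof.
move=> /andP[e0 e1] QC.
pose s := qform_sup m c; have s0 : 0 < s := qform_sup_gt0 m c.
(* Makes the cells so small that one which meets the ellipsoid of radius 1 - e lies inside the unit
   ellipsoid. *)
pose N := Num.truncn (2 * s / e).
have qe0 : 0 <= 2 * s / e by rewrite divr_ge0 ?mulr_ge0 ?ltW.
have := truncn_itv qe0; rewrite -/N => /andP[_ Ne].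
pose h : R := 2 / N.+1%:R.
have N0 : 0 < N.+1%:R :> R by [].
have h0 : 0 < h by rewrite divr_gt0.
have hs : s * h < e.
  by rewrite /h mulrA ltr_pdivrMr//; move: Ne; rewrite ltr_pdivrMr//; lra.
have hN : h * N.+1%:R = 2 by rewrite /h divfK// gt_eqF.
pose E := @ellipsoid R m c 1.
pose S : {set {ffun 'I_m -> 'I_N.+1}} := [set k | `[< cell (-1) h k `<=` E >]]%SET.
have SE : ((1 - e) ^+ m * b <= #|S|%:R * h ^+ m).
  have e10 : 0 < 1 - e by rewrite subr_gt0.
  rewrite -lee_fin -vol_ellipsoid//.
  apply: (@vol_le_cells R m N (-1)) => //; first exact: measurable_ellipsoid.
  move=> f fE.
  have [|k kf] := @cell_cover R m N (-1) h f h0.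
    move=> i im; rewrite hN; have := le_lt_trans (qform_coord c (coords f) im) fE.
    rewrite -real_normK ?num_real// ltr_pXn2r ?nnegrE ?(ltW e10)//.
    by rewrite ltr_norml; lra.
  exists k => //; rewrite inE; apply/asboolP => g kg; rewrite /E /ellipsoid/=.
  rewrite (@eq_qform _ _ _ _ (fun i => coords f i + (coords g i - coords f i))); last by move=> i _; ring.
  apply: (@le_lt_trans _ _ ((1 - e + s * h) ^+ 2)).
    apply: qformD => //; [exact: mulr_gt0|exact: ltW|apply: qform_le_sup; last exact: ltW].
    move=> i im; have := kf i im; have := kg i im; rewrite -natr1 ler_norml; lra.
  have sh0 : 0 < s * h by rewrite mulr_gt0.
  by rewrite ltr_pXn2r ?nnegrE//; lra.
have C0 := qcover_ge0 QC.
have cov2 : qcover ucube_diam (ucube `\` E) (#|~: S|%:R * ((h / 2) ^+ m * C)).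
  have hd : h / 2 * ucube_diam <= ucube_diam.
    rewrite ger_pMl; last by rewrite /ucube_diam lt_max ltr0n.
    by rewrite /h ler_pdivrMr// mul1r ler_pdivrMr// ler_peMr// ler1n.
  apply: (qcover_le hd); apply: (@qcover_cells N (-1)) => // f [fQ fE].
  have [|k kf] := @cell_cover R m N (-1) h f h0.
    by move=> i im; rewrite hN; have := fQ i im; lra.
  by exists k => //; rewrite !inE; apply/asboolP => /(_ _ kf).
have := qcoverU qcover_ellipsoid cov2.
apply: qcoverS.
  by move=> f fQ; have [fE|fE] := pselect (E f); [left|right].
move: b SE => bb SE; rewrite lerD2l mulrA ler_wpM2r//.
have cS : #|S|%:R + #|~: S|%:R = N.+1%:R ^+ m :> R.
  by rewrite -natrD cardsC card_ffun !card_ord natrX.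
have -> : #|~: S|%:R * (h / 2) ^+ m = 1 - #|S|%:R * (h / 2) ^+ m.
  rewrite -(addrK (#|S|%:R) (#|~: S|%:R)) [X in (X - _) * _]addrC cS mulrBl.
  by rewrite -exprMn (_ : N.+1%:R * (h / 2) = 1) ?expr1n// /h; field; rewrite gt_eqF.
have p2 : 0 < 2 ^+ m :> R by rewrite exprn_gt0.
by rewrite lerD2l lerN2 expr_div_n mulrA ler_pdivrMr// divfK// gt_eqF.
Qed.

(** The infimum I of the costs satisfies I <= 2^m + (1 - k) I, hence k I <= 2^m, where k tends to b
    / 2^m as [e] tends to 0. The limit 4^m / b is the volume 2^m of [ucube] times the cost per
    volume 2^m / b of the ellipsoid. *)
Lemma qcover_ucube_opt C : 4 ^+ m / b < C -> qcover ucube_diam ucube C.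
Proof.
move=> bC; have b0 : 0 < b := ellipsoid_vol_gt0 m c.
pose X := [set C | qcover ucube_diam ucube C].
have X0 : X !=set0 by exists ((qform_sup m c * 2) ^+ m); exact: qcover_ucube.
have lX : has_lbound X by exists 0 => x; exact: qcover_ge0.
have iX : has_inf X by split.
pose I := inf X.
have I0 : 0 <= I by apply: lb_le_inf => // x; exact: qcover_ge0.
suff IC : I <= 4 ^+ m / b.
  have [] := @inf_adherent _ X (C - I) _ iX; first by rewrite subr_gt0; lra.
  by move=> D XD; rewrite -/I addrC subrK => DC; exact: qcoverS (ltW DC) XD.
have p2 : 0 < 2 ^+ m :> R by rewrite exprn_gt0.
have E4 : 4 ^+ m = 2 ^+ m * 2 ^+ m :> R by rewrite -exprMn -natrM.
have b2 : b <= 2 ^+ m.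
  have := @vol_ellipsoid R m c 1 ltr01; rewrite expr1n mul1r -/b => vE.
  rewrite -lee_fin -vE -[2 ^+ m]mul1r.
  have <- : vol m ucube = (1 * 2 ^+ m)%:E.
    rewrite vol_box => [|i _]; last by lra.
    rewrite mul1r (eq_bigr (fun=> 2)) ?prodr_const ?card_ord// => i _; lra.
  apply: le_measure; rewrite ?inE; [exact: measurable_ellipsoid|exact: measurable_box|].
  move=> u uE i im; have := le_lt_trans (qform_coord c (coords u) im) uE.
  by rewrite -real_normK ?num_real// ltr_pXn2r ?nnegrE// ltr_norml; lra.
have step (e : R) : 0 < e < 1 -> (1 - e) ^+ m * b * I <= 4 ^+ m.
  move=> e01; have /andP[e0 e1] := e01; set k := (1 - e) ^+ m * b / 2 ^+ m.
  have k0 : 0 < k by rewrite divr_gt0// mulr_gt0// exprn_gt0// subr_gt0.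
  have k1 : k <= 1.
    rewrite /k ler_pdivrMr// mul1r; apply: le_trans b2.
    by rewrite ler_piMl ?(ltW b0)// exprn_ile1 ?subr_ge0 ?(ltW e1)// gerBl ltW.
  have kI D : X D -> I <= 2 ^+ m + (1 - k) * D.
    by move=> XD; apply: ge_inf => //; exact: qcover_refine.
  have : k * I <= 2 ^+ m.
    rewrite leNgt; apply/negP => h.
    have k10 : 0 <= 1 - k by rewrite subr_ge0.
    have [|D XD] := @inf_adherent _ X (k * I - 2 ^+ m) _ iX; first by rewrite subr_gt0.
    rewrite -/I => DI; have := kI _ XD.
    have : (1 - k) * D <= (1 - k) * (I + (k * I - 2 ^+ m)) by rewrite ler_wpM2l// ltW.
    have : 0 < k * (k * I - 2 ^+ m) by rewrite mulr_gt0 ?subr_gt0.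
    by lra.
  by rewrite /k mulrAC ler_pdivrMr// E4.
rewrite ler_pdivlMr// mulrC leNgt; apply/negP => h.
pose M : R := m%:R + 1.
have M1 : 1 <= M by rewrite /M lerDr.
(* Chosen so that (1 - M e) b I is the midpoint of 4^m and b I; Bernoulli's inequality then
   contradicts [step]. *)
pose e := (b * I - 4 ^+ m) / (2 * M * (b * I)).
have bI : 0 < b * I by apply: le_lt_trans h; rewrite exprn_ge0.
have M0 : 0 < M by lra.
have den : 0 < 2 * M * (b * I) by apply: mulr_gt0 => //; exact: mulr_gt0.
have e01 : 0 < e < 1.
  rewrite divr_gt0 ?subr_gt0//= ltr_pdivrMr// mul1r.
  have : 0 < 4 ^+ m :> R by rewrite exprn_gt0.
  have : b * I <= M * (b * I) by rewrite ler_peMl// ltW.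
  rewrite -mulrA; lra.
have e0 : 0 <= e by case/andP: e01 => /ltW.
have e1 : e <= 1 by case/andP: e01 => _ /ltW.
suff : 4 ^+ m < (1 - e) ^+ m * (b * I).
  by move: (step e e01); rewrite -(mulrA _ b I) => /le_lt_trans h' /h'; rewrite ltxx.
apply: (@lt_le_trans _ _ ((1 - m%:R * e) * (b * I))); last first.
  by rewrite ler_wpM2r ?(ltW bI)// bernoulli// e0 e1.
apply: (@lt_le_trans _ _ ((1 - M * e) * (b * I))); last first.
  by rewrite ler_wpM2r ?(ltW bI)// lerD2l lerN2 ler_wpM2r ?lerDl.
have -> : (1 - M * e) * (b * I) = b * I - (b * I - 4 ^+ m) / 2.
  rewrite /e; move: (b * I) bI (4 ^+ m) => z z0 w.
  by field; rewrite !gt_eqF.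
lra.
Qed.

End Cover.

Section Simplex.
Variable R : realType.
Local Notation mu := (@lebesgue_measure R).

Definition simplex m (w : nat -> R) (s : R) : set (Rpow R m) :=
  [set u | (forall i, (i < m)%N -> 0 <= coords u i) /\ dotp m w (coords u) <= s].

Lemma measurable_simplex m w s : measurable (@simplex m w s).
Proof.
rewrite (_ : simplex _ _ = (\bigcap_i [set u : Rpow R m | (i < m)%N -> 0 <= coords u i]) `&`
   [set u | dotp m w (coords u) <= s]); last first.
  by apply/seteqP; split => u [h1 h2]; split => //; [move=> i _ im; exact: h1|move=> i im; exact: (h1 i I)].
apply: measurableI; last by apply: measurable_le_set => //; exact: measurable_dotp.
apply: bigcapT_measurable => i; case: (i < m)%N.
  rewrite (_ : [set u | _] = [set u : Rpow R m | 0 <= coords u i]).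
    by apply: measurable_le_set => //; exact: measurable_coords.
  by apply/seteqP; split => u /= h; [exact: h|move=> _].
by rewrite (_ : [set u | _] = setT)//; apply/seteqP; split.
Qed.

Lemma vol_simplex m w s : (forall i, (i < m)%N -> 0 < w i) -> 0 <= s ->
  vol m (@simplex m w s) = (s ^+ m / (m`!%:R * \prod_(i < m) w i))%:E.
Proof.
elim: m w s => [|m IH] w s w0 s0.
  rewrite (_ : simplex _ _ = setT).
    by rewrite /= diracT big_ord0 expr0 fact0 mulr1 invr1 mul1r.
  by apply/seteqP; split => // u _; split => //; rewrite /dotp big_ord0.
pose w' i := w i.+1; pose P := \prod_(i < m) w' i.
have P0 : 0 < P by apply: prodr_gt0 => i _; apply: w0; rewrite ltnS.
have wz : 0 < w 0%N by exact: w0.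
pose K := (m`!%:R * P)^-1.
have K0 : 0 <= K by rewrite invr_ge0 mulr_ge0 ?ltW.
rewrite volS.
(* The volume of a section as a function of the remaining level p = s - w_0 x. It is extended by 0,
   so that the affine substitution can be made on the whole line; p > s corresponds to x < 0. *)
pose g : measurableTypeR R -> \bar R := fun p =>
  ((fun p => (p ^+ m * K)%:E) \_ (`[0%R, s]%classic : set (measurableTypeR R))) p.
have g0 p : (0 <= g p)%E.
  rewrite /g patchE; case: ifPn => //; rewrite inE/= in_itv/= => /andP[p0 _].
  by rewrite lee_fin mulr_ge0 ?exprn_ge0.
have mg : measurable_fun setT g.
  apply/(measurable_restrictT _ (measurable_itv `[0%R, s])).
  apply: measurable_funTS; apply/measurable_EFinP.
  by apply: measurable_funM => //; exact: measurable_funX.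
transitivity (\int[mu]_x g (- w 0%N * x + s)%R)%E.
  apply: eq_integral => x _.
  have secE : 0 <= (x : R) -> xsection (@simplex m.+1 w s) x = @simplex m w' (s - w 0%N * x).
    move=> x0; apply/seteqP; split => u; rewrite /xsection/= inE => -[h1 h2]; split.
    - by move=> i im; exact: (h1 i.+1).
    - move: h2; rewrite /dotp big_ord_recl/= => h2; rewrite lerBrDl; exact: h2.
    - by move=> [|i] //=; exact: h1.
    - by move: h2; rewrite /dotp big_ord_recl/= lerBrDl.
  rewrite /g patchE; case: ifPn.
    rewrite inE/= in_itv/= => /andP[h1 h2].
    have x0 : 0 <= (x : R) by rewrite -(pmulr_rge0 _ wz); lra.
    rewrite secE// IH//; last by lra.
      by congr (_%:E); rewrite /K; congr (_ ^+ m * _); lra.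
    by move=> i im; exact: w0.
  rewrite notin_setE/= in_itv/= => h.
  have [x0|x0] := leP 0 (x : R); last first.
    rewrite (_ : xsection _ _ = set0) ?measure0//.
    apply/seteqP; split => // u; rewrite /xsection/= inE => -[/(_ 0%N isT)/= h1 _].
    by rewrite leNgt x0 in h1.
  rewrite secE// (_ : simplex _ _ = set0) ?measure0//.
  apply/seteqP; split => // u [h1 h2]; apply: h.
  have : 0 <= dotp m w' (coords u).
    by apply: sumr_ge0 => i _; rewrite mulr_ge0 ?h1// ltW// w0// ltnS.
  have wx : 0 <= w 0%N * x by rewrite mulr_ge0// ltW.
  move=> l0; apply/andP; split; lra.
rewrite integral_affine ?oppr_eq0 ?gt_eqF// normrN gtr0_norm//.
rewrite /g -integral_mkcond.
have mf (D : set R) : measurable D -> measurable_fun D (fun p : R => (p ^+ m * K)%:E).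
  move=> mD; apply/measurable_EFinP; apply: measurable_funTS.
  by apply: measurable_funM => //; exact: measurable_funX.
transitivity ((w 0%N)^-1%:E * ((K / m.+1%:R)%:E * (s ^+ m.+1)%:E))%E; last first.
  rewrite -!EFinM; congr (_%:E); rewrite /K factS natrM big_ord_recl -/P/=.
  have mn0 : m`!%:R != 0 :> R by rewrite pnatr_eq0 -lt0n fact_gt0.
  by field; rewrite mn0 !gt_eqF//; have := ler0n R m; lra.
congr (_ * _)%E; rewrite -integral_pow//.
have -> : (\int[mu]_(x in `[0%R, s]) (x ^+ m * K)%:E = \int[mu]_(x in `]0%R, s[) (x ^+ m * K)%:E)%E.
  rewrite integral_itv_obnd_cbnd; last exact: mf.
  by rewrite integral_itv_bndo_bndc//; exact: mf.
rewrite -ge0_integralZl_EFin//.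
- apply: eq_integral => p _; rewrite -EFinM; congr (_%:E).
  by field; have := ler0n R m; rewrite gt_eqF//; lra.
- by move=> p /=; rewrite in_itv/= => /andP[p0 _]; rewrite lee_fin mulr_ge0 ?exprn_ge0// ltW.
- apply: measurable_funTS; apply/measurable_EFinP.
  by apply: measurable_funM => //; exact: measurable_funX.
- by rewrite divr_ge0.
Qed.

Variables (m : nat) (c : nat -> R).
Local Notation b := (ellipsoid_vol m c).

(** The cells of a fine grid that meet the simplex lie in the simplex of the slightly larger level
    [s + h'], so its volume [V] bounds their number. Each cell receives a scaled copy of a nearly
    optimal cover of [ucube]. *)
Lemma qcover_simplex w s dl C : (forall i, (i < m)%N -> 0 < w i) -> 0 <= s -> 0 < dl ->
  s ^+ m / (m`!%:R * \prod_(i < m) w i) * (2 ^+ m / b) < C ->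
  qcover c dl (@simplex m w s) C.
Proof.
move=> w0 s0 dl0; set K := (_ * _)^-1 => sC.
have b0 : 0 < b := ellipsoid_vol_gt0 m c.
have P0 : 0 < \prod_(i < m) w i by apply: prodr_gt0 => i _; exact: w0.
have K0 : 0 < K by rewrite invr_gt0 mulr_gt0// ltr0n fact_gt0.
have p2 : 0 < 2 ^+ m :> R by rewrite exprn_gt0.
have e0 : 0 < (C - K * (2 ^+ m / b) * s ^+ m) / 2.
  by rewrite divr_gt0// subr_gt0 mulrC mulrA.
have [h' h'0 hP] := pow_continuity m (K * (2 ^+ m / b)) s e0.
pose V := (s + h') ^+ m * K.
have V0 : 0 < V by rewrite mulr_gt0// exprn_gt0// ltr_wpDl.
have VC : V * (2 ^+ m / b) < C.
  rewrite /V (mulrC _ K) mulrAC; apply: le_lt_trans hP _.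
  by move: e0; set z := K * _ * _; lra.
(* The allowance for a cube of volume 2^m when a set of volume [V] may cost [C]. *)
pose C1 := C * 2 ^+ m / V.
have C1P : 4 ^+ m / b < C1.
  rewrite /C1 ltr_pdivlMr//.
  have -> : 4 ^+ m = 2 ^+ m * 2 ^+ m :> R by rewrite -exprMn -natrM.
  have -> : 2 ^+ m * 2 ^+ m / b * V = V * (2 ^+ m / b) * 2 ^+ m by ring.
  by rewrite ltr_pM2r.
have QC := qcover_ucube_opt C1P.
pose W := 1 + \sum_(i < m) w i.
have W1 : 1 <= W by rewrite lerDl sumr_ge0// => i _; exact/ltW/w0.
have W0 : 0 < W by exact: lt_le_trans W1.
have d00 : 0 < ucube_diam m c by rewrite /ucube_diam lt_max ltr0n.
(* The first bound keeps the cells inside the enlarged simplex, the second keeps the diameters of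
   the scaled covers below [dl]. *)
pose h := Num.min (h' / W) (2 * dl / ucube_diam m c).
have h0 : 0 < h by rewrite lt_min !divr_gt0// mulr_gt0.
have hW : h * W <= h' by rewrite -ler_pdivlMr// ge_min lexx.
have hd : h / 2 * ucube_diam m c <= dl.
  have : h * ucube_diam m c <= 2 * dl by rewrite -ler_pdivlMr// ge_min lexx orbT.
  by lra.
pose z := (\sum_(i < m) s / w i) / h.
have sw i : (i < m)%N -> 0 <= s / w i by move=> im; rewrite divr_ge0// ltW// w0.
have z0 : 0 <= z by rewrite divr_ge0 ?(ltW h0)// sumr_ge0// => i _; exact: sw.
pose N := Num.truncn z.
have /andP[_ zN] := truncn_itv z0; rewrite -/N in zN.
pose D := @simplex m w s.
pose S : {set {ffun 'I_m -> 'I_N.+1}} :=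
  [set k | `[< (cell 0 h k `&` D) !=set0 >]]%SET.
have SD : #|S|%:R * h ^+ m <= V.
  rewrite -lee_fin /V -vol_simplex//; last by rewrite addr_ge0// ltW.
  apply: (@cells_le_vol R m N 0) => //; first exact: measurable_simplex.
  move=> k; rewrite inE => /asboolP[g [gk [g0 gs]]] f fk; split.
    move=> i im; have /andP[+ _] := fk i im; apply: le_trans.
    by rewrite add0r mulr_ge0// ltW.
  apply: le_trans (_ : dotp m w (coords g) + h * W <= _); last by rewrite lerD.
  rewrite /dotp /W mulrDr mulr1 mulr_sumr.
  apply: (@le_trans _ _ (\sum_(i < m) w i * coords g i + \sum_(i < m) h * w i)); last first.
    by rewrite lerD2l lerDr ltW.
  rewrite -big_split/=; apply: ler_sum => i _.
  have := fk i (ltn_ord i); have := gk i (ltn_ord i); rewrite -natr1 => /andP[a1 _] /andP[_ a2].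
  rewrite (mulrC h) -mulrDr ler_pM2l ?w0//; lra.
have DS f : D f -> exists2 k, k \in S & cell 0 h k f.
  move=> Df; have [f0 fs] := Df.
  have [|k kf] := @cell_cover R m N 0 h f h0.
    move=> i im; rewrite f0//= add0r.
    apply: (@le_lt_trans _ _ (h * z)); last by rewrite ltr_pM2l.
    rewrite /z mulrC divfK ?gt_eqF// (bigD1 (Ordinal im))//=.
    apply: (@le_trans _ _ (s / w i)); last first.
      by rewrite lerDl sumr_ge0// => j _; exact: sw.
    rewrite ler_pdivlMr ?w0// mulrC; apply: le_trans fs.
    rewrite /dotp (bigD1 (Ordinal im))//= lerDl sumr_ge0// => j _.
    by rewrite mulr_ge0 ?f0// ltW// w0.
  by exists k => //; rewrite inE; apply/asboolP; exists f.
apply: (qcoverS _ _ (qcover_le hd (qcover_cells h0 QC DS))) => //.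
have -> : #|S|%:R * ((h / 2) ^+ m * C1) = #|S|%:R * h ^+ m * (C / V).
  by rewrite expr_div_n /C1; field; rewrite !gt_eqF.
have C0 : 0 < C by apply: le_lt_trans VC; rewrite mulr_ge0 ?(ltW V0)// divr_ge0 ?ltW.
apply: (@le_trans _ _ (V * (C / V))); last by rewrite mulrC divfK// gt_eqF.
by rewrite ler_wpM2r// divr_ge0 ?ltW.
Qed.


End Simplex.

(** * Hausdorff measure and the boundary of the cube *)

Section Hausdorff.
Variable R : realType.

Lemma ediam_ge0 n (A : set 'rV[R]_n) : (0 <= ediam A)%E.
Proof. by apply: ereal_sup_ubound; left. Qed.

Lemma ediam_ub n (A : set 'rV[R]_n) x y : A x -> A y -> ((edist x y)%:E <= ediam A)%E.
Proof. by move=> Ax Ay; apply: ereal_sup_ubound; right; exists x, y. Qed.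

Lemma ediam_le n (A : set 'rV[R]_n) (d : R) : 0 <= d ->
  (forall x y, A x -> A y -> edist x y <= d) -> (ediam A <= d%:E)%E.
Proof.
move=> d0 Ad; apply: ge_ereal_sup => _ [->|[x [y [Ax [Ay ->]]]]]; first by rewrite lee_fin.
by rewrite lee_fin Ad.
Qed.

Section ecover.
Variables (n m : nat) (dl : R).
Hypotheses (m0 : (0 < m)%N) (dl0 : 0 < dl).

Definition small_piece (p : set 'rV[R]_n * R) :=
  0 <= p.2 <= dl /\ (forall x y, p.1 x -> p.1 y -> edist x y <= p.2).

(** The default [(set0, 0)] of [nth] pads a finite list to a sequence as in [hausdorff_delta]; the
    padding costs nothing because 0 < m. The numbers only bound the diameters, as those in [qcover]
    do. *)
Definition ecover (A : set 'rV[R]_n) (C : R) := exists s : seq (set 'rV[R]_n * R),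
  [/\ forall i, small_piece (nth (set0, 0) s i),
      A `<=` \bigcup_i (nth (set0, 0) s i).1 &
      \sum_(p <- s) p.2 ^+ m <= C].

Lemma ecover0 : ecover set0 0.
Proof.
exists [::]; split => //; last by rewrite big_nil.
by move=> i; rewrite nth_nil; split=> //=; rewrite lexx ltW.
Qed.

Lemma ecover1 (A : set 'rV[R]_n) d : 0 <= d <= dl -> (forall x y, A x -> A y -> edist x y <= d) ->
  ecover A (d ^+ m).
Proof.
move=> dd Ad; exists [:: (A, d)]; split; last by rewrite big_seq1.
  by case=> [|i]//=; rewrite nth_nil; split=> //=; rewrite lexx ltW.
by move=> x Ax; exists 0%N.
Qed.

Lemma ecoverU A B C D : ecover A C -> ecover B D -> ecover (A `|` B) (C + D).
Proof.
move=> [s [s1 s2 s3]] [r [r1 r2 r3]]; exists (s ++ r); split.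
- by move=> i; rewrite nth_cat; case: ifP => _; [exact: s1|exact: r1].
- move=> x [/s2[i _]|/r2[i _]] xi; last first.
    by exists (size s + i)%N => //; rewrite nth_cat ltnNge leq_addr/= addKn.
  exists i => //; rewrite nth_cat; case: ltnP => // si.
  by move: xi; rewrite nth_default.
- by rewrite big_cat/= lerD.
Qed.

Lemma ecoverS A B C D : B `<=` A -> C <= D -> ecover A C -> ecover B D.
Proof.
move=> BA CD [s [s1 s2 s3]]; exists s; split => //; first exact: subset_trans s2.
exact: le_trans CD.
Qed.

Lemma ecover_bigcup (I : finType) (F : I -> set 'rV[R]_n) (C : I -> R) :
  (forall i, ecover (F i) (C i)) -> ecover (\bigcup_i F i) (\sum_i C i).
Proof.
move=> FC.
have : ecover (\big[setU/set0]_i F i) (\sum_i C i).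
  by elim/big_rec2: _ => [|i A D _ h]; [exact: ecover0|exact: ecoverU].
apply: ecoverS => // x [i _ xi].
by rewrite (bigD1 i)//=; left.
Qed.

Lemma ecover_hausdorff_delta A C : ecover A C ->
  (hausdorff_delta m dl A <= (ball_vol R m / 2 ^+ m * C)%:E)%E.
Proof.
move=> [s [s1 s2 s3]].
pose E k := (nth (set0, 0 : R) s k).1.
have Ed k : (ediam (E k) <= (nth (set0, 0 : R) s k).2%:E)%E.
  by have [/andP[h1 _] h2] := s1 k; exact: ediam_le.
pose K : R := ball_vol R m / 2 ^+ m.
have K0 : 0 <= K by rewrite divr_ge0 ?exprn_ge0// ltW// ball_vol_gt0.
apply: (@le_trans _ _ (\sum_(0 <= k <oo) (K * (fine (ediam (E k))) ^+ m)%:E)%E).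
  apply: ereal_inf_lbound; exists E; split => //.
  by move=> k; apply: (le_trans (Ed k)); rewrite lee_fin; have [/andP[]] := s1 k.
have fE k : fine (ediam (E k)) <= (nth (set0, 0 : R) s k).2.
  have := Ed k; have := ediam_ge0 (E k).
  by case: (ediam (E k)) => [r|//|//]; rewrite !lee_fin.
have fE0 k : 0 <= fine (ediam (E k)) by rewrite fine_ge0// ediam_ge0.
rewrite (nneseries_split 0 (size s)); last by move=> k _; rewrite lee_fin mulr_ge0// exprn_ge0.
rewrite [X in (_ + X)%E]eseries0 ?adde0; last first.
  move=> k; rewrite add0n => sk _; rewrite (_ : fine _ = 0).
    by rewrite expr0n -[m]prednK//= mulr0.
  apply/eqP; rewrite eq_le fE0 andbT; apply: (le_trans (fE k)).
  by rewrite nth_default.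
rewrite add0n sumEFin lee_fin -mulr_sumr ler_wpM2l//.
apply: le_trans s3; rewrite (big_nth (set0, 0)); apply: ler_sum => k _.
by rewrite lerXn2r ?nnegrE ?fE//; have [/andP[]] := s1 k.
Qed.

End ecover.

Lemma hausdorff_le n m (A : set 'rV[R]_n) (C : R) : (0 < m)%N ->
  (forall e dl, 0 < e -> 0 < dl -> ecover m dl A (C + e)) ->
  (hausdorff m A <= (ball_vol R m / 2 ^+ m * C)%:E)%E.
Proof.
move=> m0 AC; apply: ge_ereal_sup => _ [dl dl0 <-].
have K0 : 0 < ball_vol R m / 2 ^+ m by rewrite divr_gt0 ?exprn_gt0// ball_vol_gt0.
apply/lee_addgt0Pr => e e0.
apply: (le_trans (ecover_hausdorff_delta m0 (AC (e / (ball_vol R m / 2 ^+ m)) dl _ dl0))).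
  by rewrite divr_gt0.
by rewrite -EFinD lee_fin mulrDr mulrC [X in _ + X]mulrC divfK ?gt_eqF// mulrC.
Qed.

Lemma hausdorff_ge n m (A : set 'rV[R]_n) (C dl : R) : 0 < dl ->
  (forall (E : nat -> set 'rV[R]_n), (forall k, (ediam (E k) <= dl%:E)%E) ->
    A `<=` \bigcup_k E k ->
    (C%:E <= \sum_(0 <= k <oo)
       (ball_vol R m / 2 ^+ m * fine (ediam (E k)) ^+ m)%:E)%E) ->
  (C%:E <= hausdorff m A)%E.
Proof.
move=> dl0 AC; apply: (@le_trans _ _ (hausdorff_delta m dl A)); last first.
  by apply: ereal_sup_ubound; exists dl.
by apply: le_ereal_inf_tmp => _ [E [h1 [h2 ->]]]; exact: AC.
Qed.

Lemma closed_cube n : closed (@cube R n).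
Proof.
rewrite (_ : cube n = \bigcap_i ((fun x : 'rV[R]_n => x ord0 i) @^-1` `[- (1 / 2), 1 / 2])).
  apply: closed_bigI => i _; apply: preimage_closed; last exact: itv_closed.
  by move=> x _; exact: coord_continuous.
apply/seteqP; split => x /= h i; first by move=> _; rewrite /= in_itv/= h.
by have := h i I; rewrite /= in_itv.
Qed.

Lemma cube_interior n (x : 'rV[R]_n) : (forall i, - (1 / 2) < x ord0 i < 1 / 2) -> interior (@cube R n) x.
Proof.
move=> xi.
exists (fun _ _ => `]- (1 / 2), 1 / 2[%classic).
  move=> k j; rewrite ord1; apply: open_nbhs_nbhs; split; first exact: interval_open.
  by rewrite /= in_itv/= xi.
move=> y yP i; have := yP ord0 i; rewrite /= in_itv/= => /andP[h1 h2].
by rewrite !ltW.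
Qed.

Lemma cube_boundaryP n (x : 'rV[R]_n) : cube_boundary n x ->
  (forall i, `|x ord0 i| <= 1 / 2) /\ exists i, `|x ord0 i| = 1 / 2.
Proof.
move=> [/closed_cube xc xi].
have x1 i : `|x ord0 i| <= 1 / 2 by rewrite ler_norml xc.
split => //; apply: contrapT => h; apply: xi; apply: cube_interior => i.
rewrite -ltr_norml lt_neqAle x1 andbT; apply/eqP => hi; apply: h; by exists i.
Qed.

Lemma cube_boundaryI n (x : 'rV[R]_n) i : (forall j, `|x ord0 j| <= 1 / 2) ->
  x ord0 i = 1 / 2 -> cube_boundary n x.
Proof.
move=> x1 xi; split.
  by apply: subset_closure => j; rewrite -ler_norml.
move=> /nbhs_ballP[e /= e0 eP].
pose y : 'rV[R]_n := x + (e / 2) *: delta_mx ord0 i.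
have yE j : y ord0 j = x ord0 j + e / 2 * (j == i)%:R by rewrite !mxE eqxx.
have e20 : 0 < e / 2 by rewrite divr_gt0.
have : cube n y.
  apply: eP; split => // k j; rewrite ord1 -ball_normE /= yE opprD addNKr normrN.
  case: (j == i); rewrite ?mulr1 ?mulr0 ?normr0// gtr0_norm//; lra.
by move=> /(_ i); rewrite yE xi eqxx mulr1 => /andP[_]; lra.
Qed.

End Hausdorff.

(** * Facets of the corner simplex *)

Section Facet.
Variable R : realType.
Variables (m : nat) (a : 'rV[R]_m.+2).
Hypothesis m0 : (0 < m)%N.
Hypothesis sa : sphere a.
Hypothesis a0 : forall i, a ord0 i != 0.

Lemma sqr_sum_le k (f : 'I_k -> R) : (\sum_j f j) ^+ 2 <= k%:R * \sum_j f j ^+ 2.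
Proof.
case: k f => [|k'] f; first by rewrite !big_ord0 mulr0 expr0n.
set k := k'.+1.
have kp : 0 < k%:R :> R by rewrite ltr0n.
set S := \sum_j f j; set Q := \sum_j _.
have : 0 <= \sum_j (f j - S / k%:R) ^+ 2 by apply: sumr_ge0 => j _; exact: sqr_ge0.
rewrite (eq_bigr (fun j => f j ^+ 2 + (- 2 * (S / k%:R) * f j + (S / k%:R) ^+ 2))); last first.
  by move=> j _; ring.
have E2 : \sum_(j < k) (S / k%:R) ^+ 2 = k%:R * (S / k%:R) ^+ 2.
  by rewrite sumr_const card_ord mulr_natl.
rewrite !big_split/= -mulr_sumr E2 -/S -/Q => h.
have : 0 <= k%:R * (Q + (- 2 * (S / k%:R) * S + k%:R * (S / k%:R) ^+ 2)) by rewrite mulr_ge0// ltW.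
rewrite (_ : _ * _ = k%:R * Q - S ^+ 2) ?subr_ge0//.
by field; rewrite gt_eqF.
Qed.

Lemma sum_lift2 (V : nmodType) (F : 'I_m.+2 -> V) i :
  \sum_j F j = F i + (F (lift i ord0) + \sum_(k < m) F (lift i (lift ord0 k))).
Proof. by rewrite (bigD1_ord i)//= big_ord_recl. Qed.

Lemma prod_lift2 (F : 'I_m.+2 -> R) i :
  \prod_j F j = F i * (F (lift i ord0) * \prod_(k < m) F (lift i (lift ord0 k))).
Proof. by rewrite (bigD1_ord i)//= big_ord_recl. Qed.

(* The facet [i] lies in [height i = 0]; the coordinate [lift i ord0] is eliminated by means of
   the equation of the hyperplane, and the coordinates [lift i (lift ord0 k)] are free. *)
Definition weight (i : 'I_m.+2) (k : nat) : R :=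
  oapp (fun k : 'I_m => `|a ord0 (lift i (lift ord0 k))|) 1 (insub k).
Definition pivot (i : 'I_m.+2) : R := `|a ord0 (lift i ord0)|.
Definition slope i k : R := weight i k / pivot i.

Lemma weightE i (k : 'I_m) : weight i k = `|a ord0 (lift i (lift ord0 k))|.
Proof. by rewrite /weight valK. Qed.

Lemma weight_gt0 i k : (k < m)%N -> 0 < weight i k.
Proof. by move=> km; rewrite (weightE i (Ordinal km)) normr_gt0. Qed.

Lemma pivot_gt0 i : 0 < pivot i. Proof. by rewrite normr_gt0. Qed.

(* Distances to the facets of the cube at the vertex that is cut off. The shift [e > 0] is used
   in the lower bound: it keeps the shrunk facets at distance at least [e] from each other. *)
Definition height (e s : R) i (u : Rpow R m) (j : 'I_m.+2) : R :=
  match unlift i j with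
  | None => 0
  | Some l => match unlift ord0 l with
    | None => (s - \sum_(k < m) weight i k * (e + coords u k)) / pivot i
    | Some k => e + coords u k
    end
  end.

Lemma height1 e s i u : height e s i u i = 0.
Proof. by rewrite /height unlift_none. Qed.

Lemma height2 e s i u : height e s i u (lift i ord0) =
  (s - \sum_(k < m) weight i k * (e + coords u k)) / pivot i.
Proof. by rewrite /height liftK unlift_none. Qed.

Lemma height3 e s i u k : height e s i u (lift i (lift ord0 k)) = e + coords u k.
Proof. by rewrite /height !liftK. Qed.

Definition facet (e s : R) i (u : Rpow R m) : 'rV[R]_m.+2 :=
  \row_j (Num.sg (a ord0 j) * (1 / 2 - height e s i u j)).

Lemma sg_sqr j : Num.sg (a ord0 j) ^+ 2 = 1.
Proof. by rewrite sqr_sg a0. Qed.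

Lemma height_sum e s i u : \sum_j `|a ord0 j| * height e s i u j = s.
Proof.
rewrite (sum_lift2 _ i) height1 mulr0 add0r.
rewrite (eq_bigr (fun k : 'I_m => weight i k * (e + coords u k))); last first.
  by move=> k _; rewrite height3 weightE.
by rewrite height2 -/(pivot i) mulrC divfK ?subrK// gt_eqF// pivot_gt0.
Qed.

(** The eliminated coordinate changes by the inner product of the slope with u - v, up to sign. This
    is the square added in [qform]; the shift [e] cancels. *)
Lemma edist_facet e s i u v :
  edist (facet e s i u) (facet e s i v) = Num.sqrt (qform m (slope i) (fun k => coords u k - coords v k)).
Proof.
rewrite /edist (eq_bigr (fun j => (height e s i u j - height e s i v j) ^+ 2)); last first.
  move=> j _; rewrite !mxE -mulrBr exprMn sg_sqr mul1r; ring.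
congr Num.sqrt; rewrite (sum_lift2 _ i) !height1 subrr expr0n/= add0r addrC !height2.
rewrite /qform /sumsq /dotp; congr (_ + _).
  by apply: eq_bigr => k _; rewrite !height3; congr (_ ^+ 2); ring.
rewrite -mulrBl -sqrrN -mulNr; congr ((_) ^+ 2).
rewrite [RHS](eq_bigr (fun k : 'I_m => (weight i k * (e + coords u k) - weight i k * (e + coords v k)) / pivot i)).
  by rewrite -mulr_suml sumrB; congr (_ / _); ring.
by move=> k _; rewrite /slope; ring.
Qed.

Lemma qcover_ecover e s i dl A C : 0 < dl -> qcover (slope i) dl A C ->
  ecover m dl (facet e s i @` A) C.
Proof.
move=> dl0; elim=> {A C} [|A d dd Ad|A B C D _ h1 _ h2|A B C D BA CD _ h1].
- by rewrite image_set0; exact: ecover0.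
- apply: ecover1 => // _ _ [u Au <-] [v Av <-]; rewrite edist_facet.
  have d0 : 0 <= d by case/andP: dd.
  by rewrite -[leRHS]ger0_norm// -sqrtr_sqr ler_wsqrtr// Ad.
- by rewrite image_setU; exact: ecoverU.
- by apply: ecoverS h1 => //; exact: image_subset.
Qed.

(** This form is independent of the coordinate that is eliminated. By [facet_volE] it is the
    Lebesgue measure of the parameter simplex times the stretching factor sqrt (1 + |slope|^2). *)
Definition facet_vol s i : R :=
  s ^+ m / (m`!%:R * \prod_j `|a ord0 j|) * (`|a ord0 i| * Num.sqrt (1 - a ord0 i ^+ 2)).

Lemma det_slope i : 1 + sumsq m (slope i) = (1 - a ord0 i ^+ 2) / pivot i ^+ 2.
Proof.
have e0 : pivot i != 0 by rewrite gt_eqF// pivot_gt0.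
apply: (mulIf (expf_neq0 2 e0)); rewrite divfK ?expf_neq0// mulrDl mul1r.
rewrite /sumsq mulr_suml (eq_bigr (fun k : 'I_m => a ord0 (lift i (lift ord0 k)) ^+ 2)).
  have := sa; rewrite /sphere/= (sum_lift2 _ i) => <-.
  by rewrite /pivot real_normK ?num_real//; ring.
move=> k _; rewrite /slope expr_div_n divfK ?expf_neq0// weightE.
by rewrite real_normK ?num_real.
Qed.

Lemma sqrt_det_slope i : Num.sqrt (1 + sumsq m (slope i)) =
  Num.sqrt (1 - a ord0 i ^+ 2) / pivot i.
Proof.
have e0 := pivot_gt0 i.
by rewrite det_slope mulrC sqrtrM ?invr_ge0 ?sqr_ge0// -exprVn sqrtr_sqr ger0_norm ?invr_ge0 ?ltW// mulrC.
Qed.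

Lemma facet_volE s i : facet_vol s i =
  s ^+ m / (m`!%:R * \prod_(k < m) weight i k) * Num.sqrt (1 + sumsq m (slope i)).
Proof.
rewrite sqrt_det_slope /facet_vol (prod_lift2 _ i) -/(pivot i).
rewrite (eq_bigr (fun k : 'I_m => weight i k)); last by move=> k _; rewrite weightE.
have mn0 : m`!%:R != 0 :> R by rewrite pnatr_eq0 -lt0n fact_gt0.
have P0 : \prod_(k < m) weight i k != 0.
  by rewrite gt_eqF//; apply: prodr_gt0 => k _; exact: weight_gt0.
have e0 : pivot i != 0 by rewrite gt_eqF// pivot_gt0.
by have := normr_eq0 (a ord0 i); rewrite (negbTE (a0 i)) => /negbT n0; field; rewrite mn0 P0 e0.
Qed.

Lemma facet_cover t s x : s = (\sum_j `|a ord0 j|) / 2 - t -> (m.+1)%:R < (2 * t) ^+ 2 -> 0 < t ->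
  (hyperplane a t `&` cube_boundary m.+2) x ->
  exists i, (facet 0 s i @` simplex (weight i) s) x.
Proof.
move=> sE t2 t0 [xt /cube_boundaryP[x1 [i xi]]].
pose y j := 1 / 2 - Num.sg (a ord0 j) * x ord0 j.
have sg1 j : `|Num.sg (a ord0 j)| = 1 by rewrite normr_sg a0.
have y01 j : 0 <= y j <= 1.
  have : `|Num.sg (a ord0 j) * x ord0 j| <= 1 / 2.
    by rewrite normrM sg1 [leLHS]mul1r; exact: x1.
  by rewrite ler_norml /y; set z := Num.sg _ * _; lra.
have ys : \sum_j `|a ord0 j| * y j = s.
  rewrite sE mulr_suml -xt -sumrB; apply: eq_bigr => j _.
  have aE : `|a ord0 j| * Num.sg (a ord0 j) = a ord0 j by rewrite mulrC -numEsg.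
  by rewrite -[X in _ = _ - X * _]aE /y; ring.
have yi : y i = 0.
  have : `|Num.sg (a ord0 i) * x ord0 i| = 1 / 2.
    by rewrite normrM sg1 [LHS]mul1r; exact: xi.
  rewrite /y; set z := Num.sg _ * _ => zE.
  have [z0|z0] := leP 0 z; first by rewrite ger0_norm// in zE; rewrite zE subrr.
  (* A point on the opposite facet has y_i = 1, hence |a_i| <= s. Then 2 t is at most the sum of the
     other |a_j|, which by Cauchy-Schwarz is at most sqrt (m + 1). *)
  exfalso.
  have y1 : y i = 1 by rewrite ltr0_norm// in zE; rewrite /y -/z; lra.
  pose b j := `|a ord0 j|.
  have ais : b i <= s.
    rewrite -ys (bigD1 i)//= y1 mulr1 lerDl sumr_ge0// => j _.
    by rewrite mulr_ge0//; case/andP: (y01 j).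
  pose S := \sum_(j < m.+1) b (lift i j).
  have SE : \sum_j `|a ord0 j| = b i + S by rewrite (bigD1_ord i).
  have bi0 : 0 <= b i by rewrite /b normr_ge0.
  have S2 : 2 * t <= S by move: ais; rewrite sE SE; lra.
  have Q : \sum_(j < m.+1) b (lift i j) ^+ 2 <= 1.
    have := sa; rewrite /sphere/= (bigD1_ord i)//= => <-.
    rewrite (eq_bigr (fun j : 'I_m.+1 => a ord0 (lift i j) ^+ 2)); last first.
      by move=> j _; rewrite real_normK ?num_real.
    by rewrite lerDr sqr_ge0.
  have CS : S ^+ 2 <= m.+1%:R * \sum_(j < m.+1) b (lift i j) ^+ 2.
    exact: sqr_sum_le.
  have : (2 * t) ^+ 2 <= S ^+ 2 by rewrite lerXn2r ?nnegrE//; lra.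
  have : m.+1%:R * \sum_(j < m.+1) b (lift i j) ^+ 2 <= m.+1%:R * 1 by rewrite ler_wpM2l.
  by lra.
exists i; exists (of_coords m (fun k => oapp (fun k : 'I_m => y (lift i (lift ord0 k))) 0 (insub k))).
  split.
    move=> k km; rewrite coords_of_coords// (_ : insub k = Some (Ordinal km))/=; last first.
      by rewrite insubT.
    by case/andP: (y01 (lift i (lift ord0 (Ordinal km)))).
  rewrite -ys (sum_lift2 _ i) yi mulr0 add0r /dotp.
  rewrite (eq_bigr (fun k : 'I_m => `|a ord0 (lift i (lift ord0 k))| * y (lift i (lift ord0 k)))).
    by rewrite lerDr mulr_ge0//; case/andP: (y01 (lift i ord0)).
  by move=> k _; rewrite weightE coords_of_coords// valK.
apply/rowP => j; rewrite mxE.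
set u := of_coords _ _.
have uE (k : 'I_m) : coords u k = y (lift i (lift ord0 k)) by rewrite coords_of_coords// valK.
suff -> : height 0 s i u j = y j.
  by rewrite /y opprB addrC subrK mulrA -expr2 sg_sqr mul1r.
have [k ->|->] := unliftP i j; last by rewrite height1 yi.
have [l ->|->] := unliftP ord0 k; first by rewrite height3 add0r uE.
rewrite height2; apply: (mulIf (lt0r_neq0 (pivot_gt0 i))); rewrite divfK ?gt_eqF ?pivot_gt0//.
rewrite -ys (sum_lift2 _ i) yi mulr0 add0r.
rewrite [X in _ - X](eq_bigr (fun k : 'I_m => `|a ord0 (lift i (lift ord0 k))| * y (lift i (lift ord0 k)))).
  by rewrite addrK mulrC.
by move=> l _; rewrite weightE add0r uE.
Qed.

Lemma perimeter_le t s : s = (\sum_j `|a ord0 j|) / 2 - t -> 0 <= s ->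
  (m.+1)%:R < (2 * t) ^+ 2 -> 0 < t ->
  (perimeter a t <= (\sum_i facet_vol s i)%:E)%E.
Proof.
move=> sE s0 t2 t0.
pose C i := s ^+ m / (m`!%:R * \prod_(k < m) weight i k) * (2 ^+ m / ellipsoid_vol m (slope i)).
have bv0 := ball_vol_gt0 R m.
have p2 : 0 < 2 ^+ m :> R by rewrite exprn_gt0.
have -> : \sum_i facet_vol s i = ball_vol R m / 2 ^+ m * \sum_i C i.
  rewrite mulr_sumr; apply: eq_bigr => i _; rewrite facet_volE /C /ellipsoid_vol.
  have : 0 < Num.sqrt (1 + sumsq m (slope i)) by rewrite sqrtr_gt0 det_gt0.
  move: (s ^+ m / _) (Num.sqrt _) => x d d0.
  by field; rewrite !gt_eqF.
apply: hausdorff_le => // e dl e0 dl0.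
pose e' := e / m.+2%:R.
have e'0 : 0 < e' by rewrite divr_gt0.
have -> : \sum_i C i + e = \sum_i (C i + e').
  by rewrite big_split/= sumr_const card_ord -mulr_natr divfK.
apply: (@ecoverS _ _ _ _ (\bigcup_i (facet 0 s i @` simplex (weight i) s)) _ _ _ _ (lexx _)).
  by move=> x /(facet_cover sE t2 t0)[i xi]; exists i.
apply: ecover_bigcup => // i; apply: qcover_ecover => //; apply: qcover_simplex => //.
- by move=> k km; exact: weight_gt0.
- by rewrite ltrDl.
Qed.

End Facet.

(** * Lower bound for the perimeter by shrunk facets *)

Section Lower.
Variable R : realType.
Variables (m : nat) (a : 'rV[R]_m.+2).
Hypothesis m0 : (0 < m)%N.
Hypothesis sa : sphere a.
Hypothesis a0 : forall i, 0 < a ord0 i.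

Let an0 i : a ord0 i != 0. Proof. by rewrite gt_eqF. Qed.

Lemma edist_coord n (x y : 'rV[R]_n) i : `|x ord0 i - y ord0 i| <= edist x y.
Proof.
rewrite /edist -sqrtr_sqr ler_wsqrtr// (bigD1 i)//= lerDl sumr_ge0// => j _.
exact: sqr_ge0.
Qed.

(** Lowering the level by [e * \sum_j a ord0 j] pays for the shift of the free coordinates and
    leaves at least [e] for the eliminated one. *)
Lemma height_ge e s i (u : Rpow R m) : 0 < e ->
  simplex (weight a i) (s - e * \sum_j a ord0 j) u ->
  forall j, j != i -> e <= height a e s i u j.
Proof.
move=> e0 [u0 us] j ji.
have [l lj|jE] := unliftP i j; last by rewrite jE eqxx in ji.
rewrite lj; have [k ->|->] := unliftP ord0 l.
  by rewrite height3 lerDl u0.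
rewrite height2 ler_pdivlMr ?pivot_gt0//.
have -> : \sum_(k < m) weight a i k * (e + coords u k) = e * (\sum_(k < m) weight a i k) + dotp m (weight a i) (coords u).
  by rewrite mulr_sumr /dotp -big_split/=; apply: eq_bigr => k _; ring.
have E : \sum_j a ord0 j = a ord0 i + (pivot a i + \sum_(k < m) weight a i k).
  rewrite (sum_lift2 _ i) /pivot gtr0_norm//; congr (_ + (_ + _)).
  by apply: eq_bigr => k _; rewrite weightE gtr0_norm.
move: us; rewrite E.
have : 0 <= e * a ord0 i by rewrite mulr_ge0 ?ltW.
lra.
Qed.

(** The condition [s <= a ord0 j] says that the vertices of the corner simplex, at distances s / a_j
    along the edges, do not leave the cube. *)
Lemma facet_section e s t i (u : Rpow R m) : 0 < e -> s = (\sum_j a ord0 j) / 2 - t ->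
  (forall j, s <= a ord0 j) ->
  simplex (weight a i) (s - e * \sum_j a ord0 j) u ->
  (hyperplane a t `&` cube_boundary m.+2) (facet a e s i u).
Proof.
move=> e0 sE sa' us.
have h0 j : 0 <= height a e s i u j.
  have [->|ji] := eqVneq j i; first by rewrite height1.
  by apply: (le_trans (ltW e0)); exact: height_ge.
have sum_h := height_sum an0 e s i u.
have h1 j : height a e s i u j <= 1.
  rewrite -(ler_pM2l (a0 j)) mulr1; apply: le_trans (sa' j).
  rewrite -[leRHS]sum_h (bigD1 j)//= gtr0_norm// lerDl sumr_ge0// => k _.
  by rewrite mulr_ge0.
have fE j : facet a e s i u ord0 j = 1 / 2 - height a e s i u j.
  by rewrite mxE gtr0_sg// mul1r.
split.
  rewrite /hyperplane/= (eq_bigr (fun j => a ord0 j / 2 - `|a ord0 j| * height a e s i u j)).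
    by rewrite sumrB sum_h -mulr_suml sE; ring.
  by move=> j _; rewrite fE gtr0_norm//; ring.
apply: (@cube_boundaryI _ _ _ i); last by rewrite fE height1 subr0.
by move=> j; rewrite fE ler_norml; have := h0 j; have := h1 j; lra.
Qed.

(** A set of diameter at most [e / 2] cannot meet two shrunk facets: coordinate j is 1/2 on facet j
    and at most 1/2 - e on the others. Hence no member of a cover is charged twice, and the lower
    bounds for the facets add up. *)
Lemma perimeter_ge_shrunk e s t : 0 < e -> s = (\sum_j a ord0 j) / 2 - t ->
  (forall j, s <= a ord0 j) -> 0 <= s - e * \sum_j a ord0 j ->
  ((\sum_i facet_vol a (s - e * \sum_j a ord0 j) i)%:E <= perimeter a t)%E.
Proof.
move=> e0 sE sa'; set s' := s - _ => s'0.
have e2 : 0 < e / 2 by rewrite divr_gt0.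
apply: (hausdorff_ge e2) => E Ed SE.
have d0 k : 0 <= fine (ediam (E k)) by rewrite fine_ge0// ediam_ge0.
have fin k : ediam (E k) \is a fin_num.
  by rewrite ge0_fin_numE ?ediam_ge0//; exact: le_lt_trans (Ed k) (ltry _).
have dE k x y : E k x -> E k y -> edist x y <= fine (ediam (E k)).
  by move=> Ex Ey; rewrite -lee_fin fineK//; exact: ediam_ub.
pose D i : set (Rpow R m) := simplex (weight a i) s'.
pose A i k : set (Rpow R m) := D i `&` [set u | E k (facet a e s i u)].
pose al := ball_vol R m / 2 ^+ m.
have al0 : 0 <= al by rewrite divr_ge0 ?exprn_ge0// ltW// ball_vol_gt0.
pose f i k : \bar R := (if A i k == set0 then 0 else al * fine (ediam (E k)) ^+ m)%:E.
have f0 i k : (0 <= f i k)%E.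
  by rewrite /f; case: ifP => _; rewrite lee_fin// mulr_ge0// exprn_ge0.
apply: (@le_trans _ _ (\sum_i \sum_(0 <= k <oo) f i k)%E).
  rewrite -sumEFin; apply: lee_sum => i _.
  rewrite facet_volE// EFinM -vol_simplex//; last by move=> k km; exact: weight_gt0.
  have q0 : 0 < Num.sqrt (1 + sumsq m (slope a i)) by rewrite sqrtr_gt0 det_gt0.
  have := @cover_lower_bound R m (slope a i) (D i) (A i) (fun k => fine (ediam (E k))).
  move=> /(_ (@measurable_simplex _ _ _ _)) h.
  rewrite muleC; apply: (@le_trans _ _ ((Num.sqrt (1 + sumsq m (slope a i)))%:E *
     \sum_(0 <= k <oo) (if A i k == set0 then 0 else
        ellipsoid_vol m (slope a i) / 2 ^+ m * fine (ediam (E k)) ^+ m)%:E)%E).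
    rewrite lee_pmul2l ?lte_fin//; apply: h => //.
      move=> u Du; have := SE _ (facet_section e0 sE sa' Du).
      by move=> [k _ Ek]; exists k.
    move=> k u v [_ uE] [_ vE]; have := dE _ _ _ uE vE.
    rewrite edist_facet// => h'.
    rewrite -[leLHS]sqr_sqrtr ?qform_ge0// lerXn2r ?nnegrE//.
  rewrite -nneseriesZl; last first.
    move=> k _; case: ifP => _; rewrite lee_fin// mulr_ge0 ?exprn_ge0// divr_ge0 ?exprn_ge0//.
    exact/ltW/ellipsoid_vol_gt0.
  apply: lee_nneseries => k _.
    rewrite -EFinM lee_fin mulr_ge0 ?(ltW q0)//; case: ifP => // _.
    rewrite mulr_ge0 ?exprn_ge0// divr_ge0 ?exprn_ge0//; exact/ltW/ellipsoid_vol_gt0.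
  rewrite /f; case: ifP => _; first by rewrite mule0.
  rewrite -EFinM lee_fin /al /ellipsoid_vol -/(Num.sqrt _) mulrA.
  by rewrite le_eqVlt; apply/orP; left; apply/eqP; field; rewrite gt_eqF// gt_eqF.
rewrite -nneseries_sum//; apply: lee_nneseries => k _.
  by rewrite sume_ge0.
have [[i Ai]|nA] := pselect (exists i, A i k != set0); last first.
  rewrite big1; first by rewrite lee_fin; exact: mulr_ge0 al0 (exprn_ge0 _ (d0 k)).
  move=> i _.
  by rewrite /f; case: ifPn => // h; exfalso; apply: nA; exists i.
rewrite (bigD1 i)//= big1 ?adde0.
  by rewrite /f (negbTE Ai).
move=> j ji; rewrite /f; case: ifPn => // /set0P[v [Dv Ev]]; exfalso.
have /set0P[u [Du Eu]] := Ai.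
have := dE _ _ _ Eu Ev; apply/negP; rewrite -ltNge.
apply: (@le_lt_trans _ _ (e / 2)); first by rewrite -lee_fin fineK.
apply: (@lt_le_trans _ _ e); first by rewrite ltr_pdivrMr//; lra.
apply: le_trans (edist_coord _ _ j).
have hu := height_ge e0 Du ji.
rewrite !mxE gtr0_sg// !mul1r height1 ler_normr; apply/orP; right.
by move: hu; set h := height _ _ _ _ _ _; lra.
Qed.

End Lower.

(** * The product inequality *)

Section Inequality.
Variable R : realType.

Lemma expR_ge_cubic (z : R) : 0 <= z -> 1 + z + z ^+ 2 / 2 + z ^+ 3 / 6 <= expR z.
Proof.
move=> z0; rewrite /expR.
have -> : 1 + z + z ^+ 2 / 2 + z ^+ 3 / 6 = series (exp_coeff z) 4.
  rewrite /series/= !big_nat_recl// big_geq// /exp_coeff/= addr0 expr0 expr1.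
  by rewrite !factS fact0 !muln1 invr1 !mulr1 !addrA.
apply: nondecreasing_cvgn_le; last exact: is_cvg_series_exp_coeff.
by apply: nondecreasing_series => n _ _; exact: exp_coeff_ge0.
Qed.

(** The extreme case d = 43/88 of [three_variable_bound]. Since 2 (1 - 43/88 (2 + Y)) = (2 - 43 Y) /
    44, it asks for B^2 (43 Y - 2) / 44 <= (1 + Y)^2. The linear [s] bounds the root of (43 Y - 2) /
    44 from above and nearly touches it, which leaves the cubic inequality B s <= 1 + Y. *)
Lemma quintic_ge0 (Y : R) : 0 <= Y -> Y <= 1 ->
  0 <= (1 + Y) ^+ 2 + 2 * (107 / 48 - 2 / 9 * Y ^+ 2) ^+ 2 * (1 - 43 / 88 * (2 + Y)).
Proof.
move=> Y0 Y1.
pose s := 3 / 5 * Y + 19 / 50; pose B := 107 / 48 - 2 / 9 * Y ^+ 2.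
have s0 : 0 <= s by rewrite /s; clear - Y0; lra.
have s2 : (43 * Y - 2) / 44 <= s ^+ 2.
  by clear - Y0; have := sqr_ge0 (Y - 181 / 250); rewrite /s; lra.
have C : B * s <= 1 + Y.
  have h1 : 0 <= (Y - 3 / 4) ^+ 2 * (Y + 3 / 2).
    by rewrite mulr_ge0 ?sqr_ge0// addr_ge0.
  by clear - h1 Y0; have := sqr_ge0 (Y - 2 / 3); rewrite /B /s; lra.
have Y21 : Y ^+ 2 <= 1 by rewrite exprn_ile1.
have Bs0 : 0 <= 1 + Y by rewrite addr_ge0.
have B0 : 0 <= B by rewrite /B; clear - Y21; lra.
have B2 : B ^+ 2 * ((43 * Y - 2) / 44) <= (1 + Y) ^+ 2.
  apply: (@le_trans _ _ (B ^+ 2 * s ^+ 2)); first by rewrite ler_wpM2l ?sqr_ge0.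
  by rewrite -exprMn lerXn2r// nnegrE; exact: mulr_ge0.
rewrite -/B; move: (B ^+ 2) B2 => b b2; clear - b2; lra.
Qed.

(** With the smallest variable [Y] fixed, [u] and [v] are replaced by their quadratic mean [X]. What
    remains is an inequality in [Y], which has a double zero at Y = 1. *)
Lemma three_variable_bound (d u v Y : R) : 0 <= d -> d <= 43 / 88 ->
  0 < Y -> Y <= u -> Y <= v -> u ^+ 2 + v ^+ 2 + Y ^+ 2 = 3 ->
  u + v + Y <= 3 - d * (1 - u * v * Y).
Proof.
move=> d0 d1 Y0 Yu Yv uvY.
have u0 : 0 < u by exact: lt_le_trans Yu.
have v0 : 0 < v by exact: lt_le_trans Yv.
have Y2u : Y ^+ 2 <= u ^+ 2 by rewrite lerXn2r ?nnegrE// ltW.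
have Y2v : Y ^+ 2 <= v ^+ 2 by rewrite lerXn2r ?nnegrE// ltW.
have Y21 : Y ^+ 2 <= 1 by clear - uvY Y2u Y2v; lra.
have Y1 : Y <= 1 by rewrite -(@ler_pXn2r _ 2) ?nnegrE ?(ltW Y0)// expr1n.
pose X := Num.sqrt ((3 - Y ^+ 2) / 2).
have X2 : X ^+ 2 = (3 - Y ^+ 2) / 2 by rewrite sqr_sqrtr//; clear - Y21; lra.
have X0 : 0 <= X by rewrite /X sqrtr_ge0.
move: X X2 X0 => X X2 X0.
have X1 : 1 <= X by rewrite -(@ler_pXn2r _ 2) ?nnegrE// expr1n X2; clear - Y21; lra.
pose A := (u + v) / 2.
have A0 : 0 <= A by rewrite /A; clear - u0 v0; lra.
have uvE : u * v = 2 * A ^+ 2 - X ^+ 2 by rewrite X2 /A; clear - uvY; lra.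
have AX : A <= X.
  rewrite -(@ler_pXn2r _ 2) ?nnegrE// X2.
  by clear - uvY; have := sqr_ge0 (u - v); rewrite /A; lra.
have XY1 : X * Y <= 1.
  rewrite -(@ler_pXn2r _ 2) ?nnegrE ?mulr_ge0 ?(ltW Y0)// expr1n exprMn X2.
  have : 0 <= (1 - Y ^+ 2) * (2 - Y ^+ 2) by rewrite mulr_ge0//; clear - Y21; lra.
  by clear; lra.
have HX : 0 <= 3 - d + d * Y * X ^+ 2 - 2 * X - Y.
  have p : 0 < 2 * (1 + X) ^+ 2 by rewrite mulr_gt0// exprn_gt0//; clear - X0; lra.
  rewrite -(pmulr_rge0 _ p).
  have -> : 2 * (1 + X) ^+ 2 * (3 - d + d * Y * X ^+ 2 - 2 * X - Y) =
     (1 - Y) ^+ 2 / 2 * ((1 + Y) ^+ 2 + 2 * (1 + X) ^+ 2 * (1 - d * (2 + Y))).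
    have h1 : 3 - 2 * X - Y = (X - 1) ^+ 2 + (1 - Y) ^+ 2 / 2.
      by clear - X2; lra.
    have h2 : 1 - Y * X ^+ 2 = (1 - Y) ^+ 2 * (2 + Y) / 2 by rewrite X2; field.
    have h3 : (1 + X) ^+ 2 * (X - 1) ^+ 2 = ((1 - Y ^+ 2) / 2) ^+ 2.
      have -> : (1 + X) ^+ 2 * (X - 1) ^+ 2 = (X ^+ 2 - 1) ^+ 2 by ring.
      by rewrite X2; field.
    have -> : 3 - d + d * Y * X ^+ 2 - 2 * X - Y = (3 - 2 * X - Y) - d * (1 - Y * X ^+ 2).
      by ring.
    rewrite h1 h2.
    have -> : 2 * (1 + X) ^+ 2 * ((X - 1) ^+ 2 + (1 - Y) ^+ 2 / 2 - d * ((1 - Y) ^+ 2 * (2 + Y) / 2)) =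
       2 * ((1 + X) ^+ 2 * (X - 1) ^+ 2) + (1 + X) ^+ 2 * (1 - Y) ^+ 2 * (1 - d * (2 + Y)) by field.
    by rewrite h3; field.
  rewrite mulr_ge0 ?divr_ge0 ?sqr_ge0//.
  have [L0|L0] := leP 0 (1 - d * (2 + Y)).
    by rewrite addr_ge0 ?sqr_ge0// mulr_ge0// mulr_ge0// sqr_ge0.
  (* From (X - 9/8)^2 >= 0 and X^2 = (3 - Y^2) / 2; this removes the square root. *)
  have XX : X <= 59 / 48 - 2 / 9 * Y ^+ 2.
    by clear - X2; have := sqr_ge0 (X - 9 / 8); lra.
  apply: le_trans (quintic_ge0 (ltW Y0) Y1) _.
  have -> : 107 / 48 - 2 / 9 * Y ^+ 2 = 1 + (59 / 48 - 2 / 9 * Y ^+ 2) by field.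
  rewrite lerD2l; set Z := 1 + (_ - _); set L := 1 - d * _.
  have ZL : (1 + X) ^+ 2 <= Z ^+ 2 by rewrite lerXn2r ?nnegrE ?lerD2l// addr_ge0//; exact: le_trans XX.
  have LL : 1 - 43 / 88 * (2 + Y) <= L.
    by rewrite /L lerD2l lerN2 ler_wpM2r// addr_ge0// ltW.
  apply: (@le_trans _ _ (2 * Z ^+ 2 * L)).
    by rewrite ler_wpM2l// mulr_ge0// sqr_ge0.
  rewrite ler_wnM2r ?(ltW L0)// ler_wpM2l//.
(* Half the gain in passing from the equal pair (X, X) to u, v with mean [A]. It is nonnegative
   since Y (A + X) <= 2 X Y <= 2 and 2 d <= 1. *)
have : 0 <= (X - A) * (1 - d * Y * (A + X)).
  rewrite mulr_ge0 ?subr_ge0//.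
  have : d * (Y * (A + X)) <= 43 / 88 * 2.
    apply: ler_pM => //; first by rewrite mulr_ge0 ?(ltW Y0)// addr_ge0.
    have : Y * A <= Y * X by rewrite ler_wpM2l// ltW.
    by clear - XY1; lra.
  by move=> h; rewrite -mulrA (le_trans h)//; clear; lra.
have -> : u + v = 2 * A by rewrite /A; field.
by rewrite uvE; clear - HX; lra.
Qed.

Lemma exp_quadratic (e : R) : e <= 3 / 4 -> expR (- (e + 4 / 3 * e ^+ 2)) <= 1 - e.
Proof.
move=> e34; set z := e + _.
have e1 : 0 < 1 - e by lra.
rewrite expRN -[_^-1]mulr1 ler_pdivrMl ?expR_gt0// mulrC.
(* Here (1 - e) (1 + z) - 1 = e^2 (1/3 - 4 e / 3), so the linear bound of exp is enough up to 1/4,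
   also for negative [e]. Beyond that the cubic Taylor polynomial is used. *)
have [e14|e14] := leP e (1 / 4).
  apply: (@le_trans _ _ ((1 - e) * (1 + z))); last by rewrite ler_wpM2l ?expR_ge1Dx// ltW.
  have : 0 <= e ^+ 2 * (1 / 3 - 4 / 3 * e) by rewrite mulr_ge0 ?sqr_ge0//; lra.
  rewrite /z; lra.
have e0 : 0 < e by lra.
have z0 : 0 <= z by rewrite /z addr_ge0 ?(ltW e0)// mulr_ge0 ?sqr_ge0.
apply: (@le_trans _ _ ((1 - e) * (1 + z + z ^+ 2 / 2 + z ^+ 3 / 6))); last first.
  by rewrite ler_wpM2l ?expR_ge_cubic// ltW.
have pw k : e ^+ k <= (3 / 4) ^+ k by rewrite lerXn2r ?nnegrE// ltW.
have Q : 0 <= e ^+ 2 * (5 / 6 - e / 3 + e ^+ 2 / 18 - 2 * e ^+ 3 / 3 - 40 / 81 * e ^+ 4 - 32 / 81 * e ^+ 5).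
  rewrite mulr_ge0 ?sqr_ge0//.
  have := pw 3%N; have := pw 4%N; have := pw 5%N; have := sqr_ge0 e.
  by move: (e ^+ 3) (e ^+ 4) (e ^+ 5) (e ^+ 2) => p3 p4 p5 p2; lra.
rewrite -subr_ge0; apply: le_trans Q _.
by rewrite le_eqVlt; apply/orP; left; apply/eqP; rewrite /z; field.
Qed.

End Inequality.

Section Product.
Variable R : realType.

Lemma prod_ge_expR (I : finType) (P : pred I) (b : I -> R) :
  (forall i, P i -> 1 / 4 <= b i) ->
  expR (- (\sum_(i | P i) (1 - b i) + 4 / 3 * \sum_(i | P i) (1 - b i) ^+ 2)) <=
  \prod_(i | P i) b i.
Proof.
move=> Pb.
rewrite mulr_sumr -big_split/= -sumrN expR_sum; apply: ler_prod => i Pi.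
rewrite expR_ge0/=; have := Pb i Pi => h.
have := @exp_quadratic R (1 - b i).
rewrite (_ : 1 - (1 - b i) = b i); last by ring.
apply.
by clear - h; lra.
Qed.

Lemma product_lower_bound k (b : 'I_k.+1 -> R) (T : R) : (3 <= k)%N ->
  (forall i, 0 < b i) -> \sum_i b i ^+ 2 = k.+1%:R ->
  k.+1%:R * k%:R < T ^+ 2 -> 0 < T -> T < k.+1%:R -> T <= \sum_i b i ->
  ((\sum_i b i - T) / (k.+1%:R - T)) ^+ 2 <= \prod_i b i.
Proof.
move=> k3 b0 b2; set n : R := k.+1%:R; set s := \sum_i b i => T2 T0 Tn Ts.
have kE : k%:R = n - 1 :> R by rewrite /n -natr1 addrK.
have n4 : 4 <= n by rewrite /n ler_nat.
move: T2; rewrite kE => T2.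
have sumC : \sum_i (1 - b i) = n - s by rewrite sumrB sumr_const card_ord.
have sumC2 : \sum_i (1 - b i) ^+ 2 = 2 * (n - s).
  rewrite (eq_bigr (fun i => 1 - b i + (b i ^+ 2 - b i))); last by move=> i _; ring.
  by rewrite big_split/= sumC sumrB b2 -/n -/s; ring.
have sn : s <= n.
  have : 0 <= 2 * (n - s) by rewrite -sumC2 sumr_ge0// => i _; exact: sqr_ge0.
  by clear; lra.
(* (n - 6/11)^2 <= n (n - 1) holds as soon as n >= 36/11. *)
have T6 : n - 6 / 11 <= T.
  have h : 0 <= n - 6 / 11 by clear - n4; lra.
  rewrite -(@ler_pXn2r _ 2)// ?nnegrE// ?(ltW T0)//.
  by apply: le_trans (ltW T2); clear - n4; lra.
set N := n - T; have N0 : 0 < N by rewrite subr_gt0.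
set r := (s - T) / N.
have r0 : 0 <= r by rewrite divr_ge0 ?subr_ge0// ltW.
have r1 : r <= 1 by rewrite ler_pdivrMr// mul1r lerD2r.
have nsE : n - s = N * (1 - r) by rewrite /r mulrBr mulr1 mulrC divfK ?gt_eqF// /N; ring.
have Dr : 11 / 6 * (2 * (n - s)) <= 2 * (1 - r).
  have : N * (1 - r) <= 6 / 11 * (1 - r).
    by rewrite ler_wpM2r ?subr_ge0// /N; clear - T6; lra.
  by rewrite -nsE; clear; lra.
have [big|small] := pselect (exists i, b i < 1 / 4); last first.
  apply: le_trans (prod_ge_expR (P := xpredT) _); last first.
    by move=> i _; rewrite leNgt; apply/negP => bi; apply: small; exists i.
  rewrite sumC sumC2.
  apply: (@le_trans _ _ (expR (r - 1) ^+ 2)).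
    rewrite lerXn2r ?nnegrE ?expR_ge0//.
    by have := expR_ge1Dx (r - 1); rewrite addrC subrK.
  rewrite -expRM_natl ler_expR; clear - Dr; lra.
have [i bi] := big.
have bi0 := b0 i.
pose y := b i; pose e := 1 - y.
have y4 : y < 1 / 4 by [].
have e34 : 3 / 4 <= e by rewrite /e; clear - y4; lra.
have e2 : 9 / 16 <= e ^+ 2.
  have : (3 / 4) ^+ 2 <= e ^+ 2 by rewrite lerXn2r ?nnegrE//; clear - e34; lra.
  by clear; lra.
have sumD : \sum_(j | j != i) (1 - b j) = (n - s) - e by rewrite -sumC [in RHS](bigD1 i)//= /e /y addrAC subrr add0r.
have sumD2 : \sum_(j | j != i) (1 - b j) ^+ 2 = 2 * (n - s) - e ^+ 2.
  by rewrite -sumC2 [in RHS](bigD1 i)//= /e /y addrAC subrr add0r.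
(* Two values below 1/4 would contribute more than 9/8 to the sum of (1 - b_j)^2, which is at most
   12/11. *)
have others j : j != i -> 1 / 4 <= b j.
  move=> ji; rewrite leNgt; apply/negP => bj.
  have : (3 / 4) ^+ 2 <= (1 - b j) ^+ 2 by rewrite lerXn2r ?nnegrE//; clear - bj; lra.
  have : (1 - b j) ^+ 2 <= 2 * (n - s) - e ^+ 2.
    by rewrite -sumD2 (bigD1 j)//= lerDl sumr_ge0// => l _; exact: sqr_ge0.
  by clear - Dr r0 e2; lra.
have P0 := prod_ge_expR others.
rewrite (bigD1 i)//= -/y.
(* Leaving out b_i raises the exponent by e + 4/3 e^2 >= 3/2, so it is at least 2 r - 1/2, and exp x
   >= 1 + x. *)
have E2 : 2 * r <= \prod_(j | j != i) b j.
  apply: le_trans P0; rewrite sumD sumD2.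
  apply: le_trans (expR_ge1Dx _); clear - Dr e34 e2; lra.
(* By Cauchy-Schwarz the other b_j sum to at most T0' = sqrt (n (n - 1)), so s - T <= y - (T - T0').
   The claim follows from N = (n - T0') - (T - T0'), n - T0' >= 1/2 and 2 y < 1. *)
have ry : r <= 2 * y.
  pose T0' := Num.sqrt (n * (n - 1)).
  have n0 : 0 <= n * (n - 1) by rewrite mulr_ge0//; clear - n4; lra.
  have T0'0 : 0 <= T0' by rewrite sqrtr_ge0.
  have T02 : T0' ^+ 2 = n * (n - 1) by rewrite sqr_sqrtr.
  have TT : T0' <= T by rewrite -(@ler_pXn2r _ 2)// ?nnegrE// ?(ltW T0)// T02 ltW.
  have nT : T0' <= n - 1 / 2.
    have h : 0 <= n - 1 / 2 by clear - n4; lra.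
    by rewrite -(@ler_pXn2r _ 2)// ?nnegrE// T02; clear - n4; lra.
  have sy : s - y <= T0'.
    have -> : s - y = \sum_j b (lift i j) by rewrite /s (bigD1_ord i)//= /y addrAC subrr add0r.
    have S0 : 0 <= \sum_j b (lift i j) by rewrite sumr_ge0// => j _; exact: ltW.
    rewrite -(@ler_pXn2r _ 2)// ?nnegrE// T02.
    apply: le_trans (sqr_sum_le _) _; rewrite kE mulrC ler_wpM2r//.
      by clear - n4; lra.
    have <- : \sum_j b j ^+ 2 = n by exact: b2.
    rewrite [leRHS](bigD1_ord i)//= lerDr; exact: sqr_ge0.
  rewrite ler_pdivrMr//.
  have : 0 <= (T - T0') * (1 - 2 * y) by rewrite mulr_ge0 ?subr_ge0//; clear - y4; lra.
  have : 0 <= y * ((n - T0') - 1 / 2) by rewrite mulr_ge0 ?(ltW bi0)//; clear - nT; lra.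
  by rewrite /N; clear - sy; lra.
apply: (@le_trans _ _ (y * (2 * r))); last by rewrite ler_wpM2l// ltW.
have : r * r <= 2 * y * r by rewrite ler_wpM2r.
by rewrite expr2; clear; lra.
Qed.

(** As r <= 1 and the exponent is at least 2, the square bound suffices. The case T = n is separate
    because r has the denominator n - T. *)
Lemma power_product_bound k (b : 'I_k.+1 -> R) (T : R) : (3 <= k)%N ->
  (forall i, 0 < b i) -> \sum_i b i ^+ 2 = k.+1%:R ->
  k.+1%:R * k%:R < T ^+ 2 -> 0 < T -> T <= k.+1%:R -> T <= \sum_i b i ->
  (\sum_i b i - T) ^+ k.-1 <= \prod_i b i * (k.+1%:R - T) ^+ k.-1.
Proof.
move=> k3 b0 b2 T2 T0; rewrite le_eqVlt => /predU1P[TE|Tn] Ts.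
  have sn : \sum_i b i <= k.+1%:R.
    have : 0 <= \sum_i (1 - b i) ^+ 2 by rewrite sumr_ge0// => i _; exact: sqr_ge0.
    rewrite (eq_bigr (fun i => 1 + (b i ^+ 2 - 2 * b i))); last by move=> i _; ring.
    rewrite big_split/= sumrB b2 -mulr_sumr sumr_const card_ord.
    by move: (\sum_i b i) => z; clear; lra.
  have -> : \sum_i b i - T = 0 by apply/eqP; rewrite subr_eq0 eq_le Ts TE sn.
  have k1 : (k.-1 == 0)%N = false by case: k k3 {b b0 b2 T2 TE Ts sn} => [|[|k]].
  by rewrite TE subrr expr0n k1 mulr0.
have := product_lower_bound k3 b0 b2 T2 T0 Tn Ts.
set s := \sum_i b i; set N := k.+1%:R - T; set r := _ / N => rP.
have N0 : 0 < N by rewrite subr_gt0.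
have r0 : 0 <= r by rewrite divr_ge0 ?subr_ge0// ltW.
have r1 : r <= 1.
  rewrite ler_pdivrMr// mul1r lerD2r.
  have : 0 <= \sum_i (1 - b i) ^+ 2 by rewrite sumr_ge0// => i _; exact: sqr_ge0.
  rewrite (eq_bigr (fun i => 1 + (b i ^+ 2 - 2 * b i))); last by move=> i _; ring.
  rewrite big_split/= sumrB b2 -mulr_sumr sumr_const card_ord -/s.
  by clear; lra.
have -> : s - T = r * N by rewrite divfK// gt_eqF.
rewrite exprMn ler_wpM2r ?exprn_ge0 ?(ltW N0)//; apply: le_trans rP.
by apply: ler_wiXn2l => //; case: k k3 {b b0 b2 T2 Tn Ts s N r N0 r0 r1} => [|[|[|k]]].
Qed.

End Product.

(** The equation [m = 1] is a hypothesis so that the lemma applies to families indexed by 'I_m.+2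
    with a variable [m]. *)
Lemma min_of_three (R : realType) m (b : 'I_m.+2 -> R) : m = 1%N ->
  exists i j k, [/\ b i <= b j, b i <= b k, \sum_l b l = b j + b k + b i,
    \prod_l b l = b j * b k * b i & \sum_l b l ^+ 2 = b j ^+ 2 + b k ^+ 2 + b i ^+ 2].
Proof.
move=> mE; move: b; rewrite mE => b.
pose i1 : 'I_3 := lift ord0 ord0; pose i2 : 'I_3 := lift ord0 (lift ord0 (ord0 : 'I_1)).
have ex i j k : (b i <= b j) && (b i <= b k) ->
    perm_eq [:: j; k; i] [:: ord0; i1; i2] ->
    exists i j k, [/\ b i <= b j, b i <= b k, \sum_l b l = b j + b k + b i,
    \prod_l b l = b j * b k * b i & \sum_l b l ^+ 2 = b j ^+ 2 + b k ^+ 2 + b i ^+ 2].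
  move=> /andP[ij ik] p; exists i, j, k.
  have S (F : 'I_3 -> R) : \sum_l F l = F j + F k + F i.
    transitivity (\sum_(l <- [:: ord0; i1; i2]) F l).
      by rewrite !big_ord_recl big_ord0 !big_cons big_nil.
    by rewrite -(perm_big _ p)/= !big_cons big_nil addr0 addrA.
  split => //; transitivity (\prod_(l <- [:: ord0; i1; i2]) b l).
    by rewrite !big_ord_recl big_ord0 !big_cons big_nil.
  by rewrite -(perm_big _ p)/= !big_cons big_nil mulr1 mulrA.
have [h01|/ltW h10] := leP (b ord0) (b i1).
  have [h02|/ltW h20] := leP (b ord0) (b i2).
    by apply: (ex ord0 i1 i2) => //; rewrite h01.
  by apply: (ex i2 ord0 i1) => //; rewrite h20 (le_trans h20).
have [h12|/ltW h21] := leP (b i1) (b i2).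
  by apply: (ex i1 ord0 i2) => //; rewrite h10.
by apply: (ex i2 ord0 i1) => //; rewrite h21 (le_trans h21).
Qed.

(* Here [x = 9/500], so that [7/4 - x = 1.732] is just below the square root of 3. *)
Lemma sqrt3_lower (R : realType) (x r : R) : 500 * x = 9 -> 0 <= r -> r ^+ 2 = 3 ->
  7 / 4 - x <= r.
Proof.
move=> xE r0 r2; rewrite leNgt; apply/negP => h.
have : r ^+ 2 < (7 / 4 - x) ^+ 2 by rewrite ltr_pXn2r ?nnegrE//; lra.
have : 0 <= x * (1 / 55 - x) by rewrite mulr_ge0; lra.
rewrite r2; lra.
Qed.

(** * Comparison with the diagonal direction *)

Section Final.
Variable R : realType.
Variables (m : nat) (t : R).
Local Notation n := m.+2.
Local Notation rn := (Num.sqrt n%:R : R).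
Hypothesis m0 : (0 < m)%N.
Hypothesis t0 : 0 < t.
Hypothesis t1 : m.+1%:R < (2 * t) ^+ 2.
Hypothesis t2 : t <= rn / 2.
Hypothesis t3 : m = 1%N -> 725 / 1000 < t.

Let rn0 : 0 < rn. Proof. by rewrite sqrtr_gt0. Qed.
Let rn2 : rn ^+ 2 = n%:R. Proof. by rewrite sqr_sqrtr. Qed.

Definition diag_value : R :=
  Num.sqrt m.+1%:R / m`!%:R * rn ^+ n * (rn / 2 - t) ^+ m.

Lemma diag_value_ge0 : 0 <= diag_value.
Proof.
apply: mulr_ge0; last by apply: exprn_ge0; rewrite subr_ge0.
apply: mulr_ge0; last by apply: exprn_ge0; exact: ltW.
by rewrite divr_ge0.
Qed.

Lemma power_bound (a : 'rV[R]_n) s : sphere a -> (forall i, a ord0 i != 0) ->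
  s = (\sum_j `|a ord0 j|) / 2 - t -> 0 <= s ->
  s ^+ m <= rn ^+ n * \prod_j `|a ord0 j| * (rn / 2 - t) ^+ m.
Proof.
move=> sa a0 sE s0.
pose b j := rn * `|a ord0 j|.
have b0 j : 0 < b j by rewrite mulr_gt0// normr_gt0.
have b2 : \sum_j b j ^+ 2 = n%:R.
  rewrite (eq_bigr (fun j => n%:R * a ord0 j ^+ 2)); last first.
    by move=> j _; rewrite exprMn rn2 real_normK ?num_real.
  by rewrite -mulr_sumr sa mulr1.
(* After multiplication by (2 sqrt n)^m, [s] becomes sum b_j - T and its maximal value becomes n -
   T. *)
pose T := 2 * t * rn.
have T0 : 0 < T by rewrite !mulr_gt0.
have T2 : n%:R * m.+1%:R < T ^+ 2.
  by rewrite /T exprMn rn2 mulrC ltr_pM2r.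
have Tn : T <= n%:R.
  by rewrite -[leRHS]rn2 expr2 /T ler_pM2r//; move: t2; rewrite ler_pdivlMr// mulrC.
have bT : \sum_j b j - T = 2 * rn * s.
  by rewrite /b -mulr_sumr sE /T; field.
have nT : n%:R - T = 2 * rn * (rn / 2 - t) by rewrite -[X in X - _ = _]rn2 /T; field.
have Ts : T <= \sum_j b j by rewrite -subr_ge0 bT mulr_ge0// mulr_ge0// ltW.
have Pb : \prod_j b j = rn ^+ n * \prod_j `|a ord0 j|.
  by rewrite /b big_split/= prodr_const card_ord.
have p0 : 0 < (2 * rn) ^+ m by rewrite exprn_gt0// mulr_gt0.
rewrite -(ler_pM2l p0) -exprMn -bT mulrCA -exprMn -nT -Pb.
case: (ltnP 1 m) => m1; first exact: power_product_bound.
have mE : m = 1%N by apply/eqP; rewrite eqn_leq m1.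
move: (t3 mE) => t725.
have bmin : exists i j k, [/\ b i <= b j, b i <= b k, \sum_l b l = b j + b k + b i,
    \prod_l b l = b j * b k * b i & \sum_l b l ^+ 2 = b j ^+ 2 + b k ^+ 2 + b i ^+ 2].
  exact: min_of_three.
have [i [j [k [ij ik sE' pE' qE']]]] := bmin.
(* T >= 1.45 * 1.732 = 2.5114, while 3 - 43/88 = 2.51136... *)
have d1 : 3 - T <= 43 / 88.
  have r2 : rn ^+ 2 = 3 by rewrite rn2 mE.
  have [x xE] : exists x : R, 500 * x = 9 by exists (9 / 500); field.
  have r1 := sqrt3_lower xE (ltW rn0) r2.
  have h1 : 0 <= (2 * t - 145 / 100) * (7 / 4 - x) by rewrite mulr_ge0//; lra.
  have h2 : 0 <= 2 * t * (rn - (7 / 4 - x)).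
    by rewrite mulr_ge0 ?subr_ge0// mulr_ge0// ltW.
  rewrite /T; lra.
have q3 : b j ^+ 2 + b k ^+ 2 + b i ^+ 2 = 3 by rewrite -qE' b2 mE.
have d0 : 0 <= 3 - T by move: Tn; rewrite mE subr_ge0.
have := three_variable_bound d0 d1 (b0 i) ij ik q3.
rewrite sE' pE'; move: (b j) (b k) (b i) => x y z.
by rewrite mE !expr1; lra.
Qed.

Lemma perimeter_bound (a : 'rV[R]_n) : sphere a -> (perimeter a t <= diag_value%:E)%E.
Proof.
move=> sa.
(* A point of the section is what gives s >= 0, and from this that no a_i vanishes; an empty section
   has perimeter 0. *)
have [[x ax]|na] := pselect ((hyperplane a t `&` cube_boundary n) !=set0); last first.
  rewrite /perimeter (_ : hyperplane a t `&` _ = set0); last first.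
    by apply/seteqP; split => // x ax; apply: na; exists x.
  apply: (@le_trans _ _ (ball_vol R m / 2 ^+ m * 0)%:E).
    apply: hausdorff_le => // e dl e0 dl0.
    by apply: ecoverS (ecover0 _ _ dl0) => //; rewrite add0r ltW.
  by rewrite mulr0 lee_fin diag_value_ge0.
pose s := (\sum_j `|a ord0 j|) / 2 - t.
have s0 : 0 <= s.
  have [xt /cube_boundaryP[x1 _]] := ax.
  rewrite subr_ge0 -xt mulr_suml; apply: ler_sum => j _.
  apply: (le_trans (ler_norm _)); rewrite normrM ler_wpM2l//.
  by have := x1 j; rewrite mul1r.
have a0 i : a ord0 i != 0.
  apply/eqP => ai; move: s0; rewrite subr_ge0 ler_pdivlMr// mulrC leNgt => /negP; apply.
  rewrite (bigD1_ord i)//= ai normr0 add0r.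
  rewrite -(@ltr_pXn2r _ 2)// ?nnegrE ?sumr_ge0 ?mulr_ge0 ?(ltW t0)//.
  apply: le_lt_trans t1; apply: (le_trans (sqr_sum_le _)).
  rewrite -[leRHS]mulr1 ler_wpM2l//.
  have : \sum_j a ord0 j ^+ 2 = 1 by exact: sa.
  rewrite (bigD1_ord i)//= ai expr0n/= add0r => <-.
  by rewrite (eq_bigr (fun j => a ord0 (lift i j) ^+ 2))// => j _; rewrite real_normK ?num_real.
apply: (le_trans (perimeter_le m0 sa a0 (erefl s) s0 t1 t0)).
rewrite lee_fin /facet_vol -mulr_sumr /diag_value.
set P := \prod_j _.
have P0 : 0 < P by apply: prodr_gt0 => j _; rewrite normr_gt0.
have fm0 : 0 < m`!%:R :> R by rewrite ltr0n fact_gt0.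
pose c : R := Num.sqrt m.+1%:R.
have c0 : 0 < c by rewrite sqrtr_gt0.
have c2 : c ^+ 2 = m.+1%:R by rewrite sqr_sqrtr.
have Q : \sum_i `|a ord0 i| * Num.sqrt (1 - a ord0 i ^+ 2) <= c.
  have a21 i : a ord0 i ^+ 2 <= 1.
    have <- : \sum_j a ord0 j ^+ 2 = 1 by exact: sa.
    by rewrite (bigD1 i)//= lerDl sumr_ge0// => j _; exact: sqr_ge0.
  apply: (@le_trans _ _ (\sum_i (c * a ord0 i ^+ 2 + (1 - a ord0 i ^+ 2) / c) / 2)).
    (* AM-GM: [|a_i| q <= (c a_i^2 + q^2 / c) / 2] *)
    apply: ler_sum => i _; set q := Num.sqrt _.
    have q2 : q ^+ 2 = 1 - a ord0 i ^+ 2 by rewrite sqr_sqrtr// subr_ge0.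
    rewrite -q2 -(@real_normK _ (a ord0 i)) ?num_real//; set z := `|_|.
    rewrite -subr_ge0 (_ : _ - _ = (c * z - q) ^+ 2 / (2 * c)); last by field; rewrite gt_eqF.
    by rewrite divr_ge0 ?sqr_ge0 ?mulr_ge0 ?(ltW c0).
  rewrite -mulr_suml big_split/= -mulr_sumr -mulr_suml sumrB sumr_const card_ord.
  have -> : \sum_j a ord0 j ^+ 2 = 1 by exact: sa.
  rewrite -[m.+2%:R]natr1 addrK -c2 mulr1.
  by rewrite le_eqVlt; apply/orP; left; apply/eqP; field; rewrite gt_eqF.
have SP := power_bound sa a0 (erefl s) s0.
rewrite -/P in SP.
apply: (@le_trans _ _ (rn ^+ n * P * (rn / 2 - t) ^+ m / (m`!%:R * P) * c)).
  rewrite ler_pM ?sumr_ge0 ?divr_ge0 ?exprn_ge0 ?mulr_ge0 ?(ltW P0)//.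
  by rewrite ler_pM2r// invr_gt0 mulr_gt0.
by rewrite le_eqVlt; apply/orP; left; apply/eqP; rewrite -/c; field; rewrite !gt_eqF.
Qed.

Let diagE i : diag_dir n ord0 i = rn^-1 :> R. Proof. by rewrite mxE. Qed.

Lemma sphere_diag : sphere (diag_dir n : 'rV[R]_n).
Proof.
rewrite /sphere/= (eq_bigr (fun=> n%:R^-1)); last by move=> i _; rewrite diagE exprVn rn2.
by rewrite sumr_const card_ord -[LHS]mulr_natr mulVf.
Qed.

Lemma sum_diag : \sum_j (diag_dir n : 'rV[R]_n) ord0 j = rn.
Proof.
rewrite (eq_bigr (fun=> rn^-1)); last by move=> i _; rewrite diagE.
by rewrite sumr_const card_ord -[LHS]mulr_natr -[X in _ * X = _]rn2 expr2 mulKf// gt_eqF.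
Qed.

Lemma facet_vol_diag s : \sum_i facet_vol (diag_dir n : 'rV[R]_n) s i =
  Num.sqrt m.+1%:R / m`!%:R * rn ^+ n * s ^+ m.
Proof.
have r0 := lt0r_neq0 rn0.
have fm0 : m`!%:R != 0 :> R by rewrite pnatr_eq0 -lt0n fact_gt0.
have PE : \prod_j `|(diag_dir n : 'rV[R]_n) ord0 j| = rn^-1 ^+ n.
  rewrite (eq_bigr (fun=> rn^-1)) ?prodr_const ?card_ord// => i _.
  by rewrite diagE gtr0_norm ?invr_gt0.
rewrite /facet_vol PE.
rewrite (eq_bigr (fun=> s ^+ m / (m`!%:R * rn^-1 ^+ n) * (rn^-1 * (Num.sqrt m.+1%:R / rn)))).
  rewrite sumr_const card_ord -[LHS]mulr_natr -[X in _ * X = _]rn2 exprVn.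
  have : rn ^+ n != 0 by rewrite expf_neq0.
  by move: (rn ^+ n) => z z0; field; rewrite ?z0 ?r0 ?fm0.
move=> i _; rewrite diagE gtr0_norm ?invr_gt0//; congr (_ * (_ * _)).
rewrite -[in RHS]sqrtrV// -[in RHS]sqrtrM//; congr Num.sqrt.
rewrite exprVn rn2; apply: (@mulIf _ (n%:R : R)); first by [].
by rewrite mulrBl mul1r mulVf// divfK// -natr1 addrK.
Qed.

Lemma perimeter_diag_ge : (diag_value%:E <= perimeter (diag_dir n : 'rV[R]_n) t)%E.
Proof.
pose s := rn / 2 - t.
have s0 : 0 <= s by rewrite subr_ge0.
have P0 : (0%:E <= perimeter (diag_dir n : 'rV[R]_n) t)%E.
  apply: (@hausdorff_ge _ _ _ _ _ 1) => // E _ _; apply: nneseries_ge0 => k _ _.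
  by rewrite lee_fin mulr_ge0 ?divr_ge0 ?exprn_ge0 ?(ltW (ball_vol_gt0 _ _)) ?fine_ge0 ?ediam_ge0.
move: s0; rewrite le_eqVlt => /predU1P[sE|s0].
  have z0 : s ^+ m = 0 by rewrite -sE expr0n (gtn_eqF m0).
  by rewrite /diag_value z0 mulr0.
have D0 := diag_value_ge0.
apply/lee_addgt0Pr => e e0.
(* The relative shrinking of the level. By Bernoulli's inequality it loses at most
   [diag_value * m * x <= e]; the summand [e] in the denominator ensures x <= 1. *)
pose x := e / (diag_value * m%:R + e).
have den : 0 < diag_value * m%:R + e by rewrite ltr_wpDl// mulr_ge0.
have x0 : 0 < x by rewrite divr_gt0.
have x1 : x <= 1 by rewrite ler_pdivrMr// mul1r lerDr mulr_ge0.
pose h := s * x / rn.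
have h0 : 0 < h by rewrite divr_gt0// mulr_gt0.
have hs : s - h * \sum_j (diag_dir n : 'rV[R]_n) ord0 j = s * (1 - x).
  by rewrite sum_diag /h divfK ?gt_eqF//; ring.
have := @perimeter_ge_shrunk _ m (diag_dir n) sphere_diag _ h s t h0.
rewrite hs facet_vol_diag sum_diag => /(_ _ (erefl _)) H.
apply: (@le_trans _ _ ((Num.sqrt m.+1%:R / m`!%:R * rn ^+ n * (s * (1 - x)) ^+ m)%:E + e%:E)%E).
  have -> : Num.sqrt m.+1%:R / m`!%:R * rn ^+ n * (s * (1 - x)) ^+ m = diag_value * (1 - x) ^+ m.
    by rewrite [in LHS]exprMn /diag_value mulrA.
  rewrite -EFinD lee_fin.
  have : diag_value * (1 - m%:R * x) <= diag_value * (1 - x) ^+ m.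
    by rewrite ler_wpM2l// bernoulli// (ltW x0).
  have : diag_value * m%:R * x <= e.
    rewrite /x mulrCA -[leRHS]mulr1 ler_wpM2l ?(ltW e0)// ler_pdivrMr// mul1r lerDl ltW//.
  by lra.
apply: leeD2r; apply: H.
- by move=> i; rewrite diagE invr_gt0.
- move=> j; rewrite diagE.
  rewrite -(ler_pM2r rn0) mulVf ?gt_eqF// /s.
  have nE : n%:R = m.+1%:R + 1 :> R by rewrite natr1.
  have m1 : 1 <= m.+1%:R :> R by rewrite ler1n.
  (* Equivalent to s <= 1 / sqrt n, the condition of [facet_section]; it follows from (n - 2)^2 <=
     (n - 1) n. *)
  have : n%:R - 2 <= 2 * t * rn.
    have h1 : 0 <= n%:R - 2 :> R by rewrite nE; lra.
    have tr0 : 0 < 2 * t * rn by rewrite !mulr_gt0.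
    rewrite -(@ler_pXn2r _ 2)// ?nnegrE// ?(ltW tr0)//.
    rewrite [leRHS]exprMn rn2.
    apply: (@le_trans _ _ (m.+1%:R * n%:R)); last by rewrite ler_wpM2r// ltW.
    by rewrite nE; move: m1; lra.
  have -> : (rn / 2 - t) * rn = (rn ^+ 2 - 2 * t * rn) / 2 by field.
  by rewrite rn2; lra.
- by rewrite mulr_ge0 ?(ltW s0)// subr_ge0.
Qed.

End Final.

Theorem theorem5 (R : realType) (n : nat) (t : R) :
  (((4 <= n)%N /\ Num.sqrt (n.-1)%:R / 2 < t /\ t <= Num.sqrt n%:R / 2)
   \/ (n = 3%N /\ 725 / 1000 < t /\ t <= Num.sqrt 3 / 2)) ->
  forall a : 'rV[R]_n, sphere a ->
    (perimeter a t <= perimeter (diag_dir n) t)%E /\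
    perimeter (diag_dir n) t =
      (Num.sqrt (n.-1)%:R / (n.-2)`!%:R * Num.sqrt n%:R ^+ n
         * (Num.sqrt n%:R / 2 - t) ^+ n.-2)%:E.
Proof.
move=> H a sa.
have [m nE] : exists m, n = m.+2.
  by case: H => [[n4 _]|[-> _]]; [exists n.-2; case: n n4 {a sa} => [|[|n]]|exists 1%N].
subst n.
have [m0 t0 t1 t2 t3] : [/\ (0 < m)%N, 0 < t, m.+1%:R < (2 * t) ^+ 2,
    t <= Num.sqrt m.+2%:R / 2 & (m = 1%N -> 725 / 1000 < t)].
  case: H => [[n4 [h1 h2]]|[[mE] [h1 h2]]].
    have q0 : 0 <= Num.sqrt m.+1%:R :> R by [].
    have t0 : 0 < t by apply: le_lt_trans h1; rewrite divr_ge0.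
    have t20 : 0 <= 2 * t by rewrite mulr_ge0// ltW.
    split => //.
    - by case: m n4 {a sa h1 h2 q0} => [|m].
    - rewrite -[ltLHS](@sqr_sqrtr R m.+1%:R)// ltr_pXn2r ?nnegrE//.
      by move: h1; rewrite ltr_pdivrMr// mulrC.
    - by move=> mE; rewrite mE in n4.
  rewrite mE; split => //.
  - by clear - h1; lra.
  - have : 0 < (2 * t - 29 / 20) * (2 * t + 29 / 20).
      by rewrite mulr_gt0//; clear - h1; lra.
    by clear; lra.
have up := perimeter_bound m0 t0 t1 t2 t3.
have E : perimeter (diag_dir m.+2) t = (diag_value m t)%:E.
  by apply/eqP; rewrite eq_le up ?perimeter_diag_ge//; exact: sphere_diag.
by rewrite E; split => //; exact: up.
Qed.
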